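(* The time-bounded quantitative reachability problem for $2\frac{1}{2}$-player stochastic timed games is undecidable for games with $5$ or more clocks. That is, there is no algorithm which, given a $2\frac12$-player stochastic timed game $\mathcal{G}$ with at least $5$ clocks, a set $T$ of target locations, an initial state $s_0$, a time bound $\Delta$, and a threshold $\bowtie p$ with $p\in(0,1)\cap\mathbb{Q}$, decides whether Player $\Diamond$ has a strategy $\lambda_\Diamond$ such that for every strategy $\lambda_\Box$ of Player $\Box$, the probability of the set of runs from $s_0$ that visit $T$ within $\Delta$ time units is $\bowtie p$.
   Context: Clocks are real-valued variables; a valuation $\nu$ assigns a non-negative real to each clock; $\nu+t$ adds $t$ to every clock and $\nu[X:=0]$ resets the clocks in $X$. A clock constraint is a finite conjunction of constraints $x\bowtie k$ with $k\in\mathbb{Z}_{\ge0}$, $\bowtie\in\{<,\le,=,>,\ge\}$. A timed automaton $\mathcal{A}=(L,\mathcal{X},E,\mathcal{I})$ has finitely many locations $L$, clocks $\mathcal{X}$, edges $E\subseteq L\times(\text{constraints})\times 2^{\mathcal{X}}\times L$, and invariants $\mathcal{I}$. States are pairs $(\ell,\nu)$ with $\nu\models\mathcal{I}(\ell)$; a transition $(\ell,\nu)\xrightarrow{t,e}(\ell',\nu')$ for $e=(\ell,g,C,\ell')$ requires $\nu+t\models g$, $\nu+t'\models\mathcal{I}(\ell)$ for all $0\le t'\le t$, and $\nu'=(\nu+t)[C:=0]$. $I(s,e)$ is the set of delays $t$ with which $e$ can be taken from $s$, and $I(s)=\bigcup_e I(s,e)$. A stochastic timed game (STG) is $\mathcal{G}=(\mathcal{A},(L_\Box,L_\Diamond,L_\bigcirc),\omega,\mu)$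 where $L_\Box,L_\Diamond,L_\bigcirc$ partition $L$ (locations of Player $\Box$, Player $\Diamond$, and the stochastic player), $\omega$ assigns a positive integer weight to each edge leaving $L_\bigcirc$, and $\mu$ assigns to each state $s$ with location in $L_\bigcirc$ a probability measure $\mu(s)$ on $I(s)$ such that, if $I(s)$ has positive Lebesgue measure, $\mu(s)$ and Lebesgue measure have the same null subsets of $I(s)$. From a stochastic state $s$ a delay $t$ is drawn according to $\mu(s)$, then an enabled edge $e$ in $s+t$ is chosen with probability proportional to $\omega(e)$ among enabled edges. A (deterministic) strategy for Player $\Diamond$ (resp. $\Box$) maps each finite run ending in a state whose location is in $L_\Diamond$ (resp. $L_\Box$) to a delay–edge pair that can be taken; strategy profiles are required to be measurable, and a profile with an initial state induces a probability measure on infinite runs. A general STG (both $L_\Box$ and $L_\Diamond$ possibly nonempty) is called a $2\frac12$-player STG. In the time-bounded version of quantitative reachability one requires that the probability of runs visiting a target location within total elapsed time $\Delta$ be $\bowtie p$, for $0<p<1$. *)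

(* Defs.v *)
(* MathComp / MathComp-Analysis *)
From HB Require Import structures.
From mathcomp Require Import finmap.
From mathcomp Require Import all_boot all_order all_algebra.
From mathcomp Require Import all_classical all_reals all_analysis.
From mathcomp Require Import measurable_realfun.

Set Implicit Arguments.
Unset Strict Implicit.
Unset Printing Implicit Defensive.

Import Order.TTheory GRing.Theory Num.Theory.
Import numFieldNormedType.Exports.

Local Open Scope classical_set_scope.
Local Open Scope ring_scope.

(** ** Comparison symbols, used for clock constraints and for thresholds *)

Inductive cmp := CLt | CLe | CEq | CGe | CGt.

Definition cmp_holds d (T : porderType d) (c : cmp) (x y : T) : bool :=
  match c with
  | CLt => (x < y)%O
  | CLe => (x <= y)%O
  | CEq => x == y
  | CGe => (y <= x)%O
  | CGt => (y < x)%O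
  end.

Definition nat_of_cmp (c : cmp) : nat :=
  match c with CLt => 0 | CLe => 1 | CEq => 2 | CGe => 3 | CGt => 4 end.

Definition cmp_of_nat (m : nat) : option cmp :=
  nth None [:: Some CLt; Some CLe; Some CEq; Some CGe; Some CGt] m.

Lemma nat_of_cmpK : pcancel nat_of_cmp cmp_of_nat.
Proof. by case. Qed.

HB.instance Definition _ := Countable.copy cmp (pcan_type nat_of_cmpK).

(** ** Timed automata with [n.+1] locations and [k] clocks.
    The set of locations is nonempty because it contains an initial one. *)

Definition constraint (k : nat) := seq ('I_k * cmp * nat).

Record edge (n k : nat) := Edge {
  src : 'I_n.+1;
  guard : constraint k;
  resets : {set 'I_k};
  tgt : 'I_n.+1 }.

Section EdgeStructures.
Context (n k : nat).

Let edge_tuple := ('I_n.+1 * seq ('I_k * cmp * nat) * seq 'I_k * 'I_n.+1)%type.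

Definition tuple_of_edge (e : edge n k) : edge_tuple :=
  (src e, guard e, enum (resets e), tgt e).

Definition edge_of_tuple (x : edge_tuple) : edge n k :=
  let: (l, g, C, l') := x in Edge l g [set i in C]%SET l'.

Lemma tuple_of_edgeK : cancel tuple_of_edge edge_of_tuple.
Proof. by case=> l g C l' /=; rewrite /edge_of_tuple set_enum. Qed.

HB.instance Definition _ := Countable.copy (edge n k) (can_type tuple_of_edgeK).
HB.instance Definition _ := isPointed.Build (edge n k) (Edge ord0 [::] finset.set0 ord0).
HB.instance Definition _ := @isMeasurable.Build default_measure_display
  (edge n k) discrete_measurable discrete_measurable0
  discrete_measurableC discrete_measurableU.

End EdgeStructures.

(* [edges] lists the finite set of edges; it is required to be duplicate-free
   in [is_stg] below. *)
Record timed_automaton (n k : nat) := TimedAutomaton {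
  edges : seq (edge n k);
  invariant : 'I_n.+1 -> constraint k }.

Section Semantics.
Context (R : realType) (n k : nat).

Definition valuation := k.-tuple R.
Definition state := ('I_n.+1 * valuation)%type.
(* the label (t, e) of a transition *)
Definition move := (R * edge n k)%type.

Definition sat (v : valuation) (c : constraint k) : bool :=
  all (fun a : 'I_k * cmp * nat => cmp_holds a.1.2 (tnth v a.1.1) a.2%:R) c.

Definition delay (v : valuation) (t : R) : valuation :=
  [tuple tnth v i + t | i < k].

Definition reset (v : valuation) (C : {set 'I_k}) : valuation :=
  [tuple if i \in C then 0 else tnth v i | i < k].

Definition is_state (A : timed_automaton n k) (s : state) : Prop :=
  (forall i, 0 <= tnth s.2 i) /\ sat s.2 (invariant A s.1).

Definition post (s : state) (m : move) : state :=
  (tgt m.2, reset (delay s.2 m.1) (resets m.2)).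

(* [m] labels a transition from [s] to [post s m]; that the latter is again
   a state amounts to the invariant of the target location. *)
Definition can_take (A : timed_automaton n k) (s : state) (m : move) : Prop :=
  [/\ m.2 \in edges A, src m.2 = s.1 & 0 <= m.1] /\
  [/\ sat (delay s.2 m.1) (guard m.2),
      (forall t', 0 <= t' <= m.1 -> sat (delay s.2 t') (invariant A s.1)) &
      sat (post s m).2 (invariant A (tgt m.2))].

Definition edge_delays (A : timed_automaton n k) (s : state) (e : edge n k)
    : set R :=
  [set t | can_take A s (t, e)].

Definition delays (A : timed_automaton n k) (s : state) : set R :=
  \bigcup_(e in [set` edges A]) edge_delays A s e.

(* A finite run s0 -(t1,e1)-> s1 -(t2,e2)-> ... is represented by s0 and its
   labels, which determine the intermediate states. *)
Definition last_state (s : state) (h : seq move) : state := foldl post s h.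

Fixpoint is_run (A : timed_automaton n k) (s : state) (h : seq move) : Prop :=
  if h is m :: h' then can_take A s m /\ is_run A (post s m) h' else True.

End Semantics.

(** ** Stochastic timed games *)

Inductive player := Box | Diamond | Stochastic.

Definition option_of_player (p : player) : option bool :=
  match p with Box => Some false | Diamond => Some true | Stochastic => None end.

Definition player_of_option (o : option bool) : player :=
  match o with Some false => Box | Some true => Diamond | None => Stochastic end.

Lemma option_of_playerK : cancel option_of_player player_of_option.
Proof. by case. Qed.

HB.instance Definition _ := Countable.copy player (can_type option_of_playerK).

(* The finite part of a game. [weight] is only relevant for the edges that
   leave a stochastic location. *)
Record arena (n k : nat) := Arena {
  automaton :> timed_automaton n k;
  owner : 'I_n.+1 -> player;
  weight : edge n k -> nat }.

(* Only the values at states of stochastic locations are relevant. *)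
Definition delay_measures (R : realType) (n k : nat) :=
  state R n k -> probability R R.

(* Measurability of s |-> mu s is the implicit condition under which a profile
   induces a probability measure on runs. *)
Definition is_stg (R : realType) (n k : nat)
    (G : arena n k) (mu : delay_measures R n k) : Prop :=
  [/\ uniq (edges G),
      (forall e, e \in edges G -> owner G (src e) = Stochastic ->
         (0 < weight G e)%N),
      (forall s, is_state G s -> owner G s.1 = Stochastic ->
         mu s (delays G s) = 1%E /\
         ((0 < lebesgue_measure (delays G s))%E ->
          forall N : set R, measurable N -> N `<=` delays G s ->
            (mu s N = 0%E <-> lebesgue_measure N = 0%E))) &
      (forall l, owner G l = Stochastic ->
         forall B : set R, measurable B ->
         measurable_fun [set v : valuation R k | is_state G (l, v)]
           (fun v => mu (l, v) B))].

Section Games.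
Context (R : realType) (n k : nat).
Variables (G : arena n k) (mu : delay_measures R n k) (s0 : state R n k).

(* Only the values on runs from [s0] that end in a location of the player
   are relevant. *)
Definition strategy := seq (move R n k) -> move R n k.

Definition player_runs (p : player) : set (seq (move R n k)) :=
  [set h | is_run G s0 h /\ owner G (last_state s0 h).1 = p].

Definition is_strategy (p : player) (sigma : strategy) : Prop :=
  (forall h, player_runs p h -> can_take G (last_state s0 h) (sigma h)) /\
  (forall m, measurable_fun
     [set h : m.-tuple (move R n k) | player_runs p h] (fun h => sigma h)).

Definition total_weight (s : state R n k) (t : R) : R :=
  \sum_(e <- edges G | `[< can_take G s (t, e) >]) (weight G e)%:R.

(* Law of the label of the transition that follows the finite run [h] *)
Definition step_law (sigmaD sigmaB : strategy) (h : seq (move R n k))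
    (B : set (move R n k)) : \bar R :=
  let s := last_state s0 h in
  match owner G s.1 with
  | Diamond => \d_(sigmaD h) B
  | Box => \d_(sigmaB h) B
  | Stochastic =>
      \int[mu s]_(t in delays G s)
        (\sum_(e <- edges G | `[< can_take G s (t, e) /\ B (t, e) >])
           (weight G e)%:R / total_weight s t)%:E
  end.

Definition cylinders : set (set (nat -> move R n k)) :=
  [set C | exists i, exists2 B, measurable B & C = [set w | B (w i)]].

(* Label sequences with the product sigma-algebra *)
Definition paths := g_sigma_algebraType cylinders.

Definition run_prefix (m : nat) (w : paths) : m.-tuple (move R n k) :=
  [tuple w i | i < m].

Definition infinite_runs : set paths := [set w | forall m, is_run G s0 (run_prefix m w)].

(* [P] is the law of the process whose (m+1)-st label has conditional law
   [step_law] given the first m labels; by the Ionescu-Tulcea theorem there is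
   exactly one such [P] when [is_stg G mu] holds and both arguments are
   strategies in the sense of [is_strategy]. *)
Definition induces (sigmaD sigmaB : strategy) (P : probability paths R) : Prop :=
  forall m (A : set (m.-tuple (move R n k))) (B : set (move R n k)),
    measurable A -> measurable B ->
    P [set w | A (run_prefix m w) /\ B (w m)] =
    (\int[P]_(w in [set w | A (run_prefix m w)])
       step_law sigmaD sigmaB (run_prefix m w) B)%E.

Definition reach (T : {set 'I_n.+1}) (D : R) : set paths :=
  infinite_runs `&`
  [set w | exists m, (last_state s0 (run_prefix m w)).1 \in T /\
                     \sum_(i < m) (w i).1 <= D].

Definition diamond_wins (T : {set 'I_n.+1}) (D : R) (c : cmp) (p : R) : Prop :=
  exists2 sigmaD, is_strategy Diamond sigmaD &
  forall sigmaB, is_strategy Box sigmaB ->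
  exists2 P : probability paths R, induces sigmaD sigmaB P &
    cmp_holds c (P (reach T D)) p%:E.

End Games.

(** ** Algorithms: Minsky register machines *)

(* [JzDec r q] jumps to instruction [q] if register [r] is zero, and otherwise
   decrements [r]; [Inc r] and a successful decrement continue with the next
   instruction. *)
Inductive instr := Inc (r : nat) | JzDec (r q : nat).

Definition config := (nat * (nat -> nat))%type.

Definition set_reg (f : nat -> nat) (r x : nat) : nat -> nat :=
  fun i => if i == r then x else f i.

Definition machine_step (M : seq instr) (c : config) : config :=
  let: (pc, f) := c in
  if (pc < size M)%N then
    match nth (Inc 0) M pc with
    | Inc r => (pc.+1, set_reg f r (f r).+1)
    | JzDec r q => if f r == 0%N then (q, f) else (pc.+1, set_reg f r (f r).-1)
    end
  else c.

(* Started with [x] in register 0 and all other registers empty, the machine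
   leaves its program with [y] in register 0. *)
Definition computes (M : seq instr) (x y : nat) : Prop :=
  exists j, let: c := iter j (machine_step M) (0%N, set_reg (fun=> 0%N) 0 x) in
    (size M <= c.1)%N /\ c.2 0%N = y.

(** ** Instances and their codes *)

(* There are uncountably many delay measures, so an instance refers to them by
   a name, interpreted by a naming scheme. *)
Definition delay_naming (R : realType) :=
  nat -> forall n k, timed_automaton n k -> delay_measures R n k.

(* Some name denotes the uniform distribution on the set of possible delays,
   whenever that set has finite positive length or is finite and nonempty. *)
Definition names_uniform (R : realType) (N : delay_naming R) : Prop :=
  exists u : nat, forall n k (A : timed_automaton n k) (s : state R n k),
    is_state A s ->
    ((0 < lebesgue_measure (delays A s) < +oo)%E ->
     forall B : set R, measurable B ->
       N u n k A s B = (fine (lebesgue_measure (B `&` delays A s)) /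
                        fine (lebesgue_measure (delays A s)))%:E) /\
    (finite_set (delays A s) -> forall t, delays A s t ->
       N u n k A s [set t] = ((#|` fset_set (delays A s)|)%fset%:R^-1)%:E).

(* Initial clock values and the time bound are rational, so that instances are
   finite objects. *)
Record instance := Instance {
  nloc : nat;
  nclock : nat;
  game : arena nloc nclock;
  delay_name : nat;
  target : {set 'I_nloc.+1};
  init_loc : 'I_nloc.+1;
  init_val : nclock.-tuple rat;
  time_bound : rat;
  threshold_rel : cmp;
  threshold : rat }.

(* Together with injectivity of [pickle], this determines the instance up to
   the values of [weight] outside of [edges]. *)
Definition code (x : instance) : nat :=
  pickle (nloc x, nclock x,
    pickle (edges (game x)),
    pickle [seq weight (game x) e | e <- edges (game x)],
    pickle [seq pickle (invariant (game x) l) | l <- enum 'I_(nloc x).+1],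
    pickle [seq owner (game x) l | l <- enum 'I_(nloc x).+1],
    delay_name x,
    pickle (enum (target x)), pickle (init_loc x), pickle (init_val x),
    time_bound x, threshold_rel x, threshold x).

Section Problem.
Context (R : realType) (N : delay_naming R).

Definition instance_measures (x : instance) : delay_measures R (nloc x) (nclock x) :=
  N (delay_name x) (game x).
Arguments instance_measures : clear implicits.

Definition init_state (x : instance) : state R (nloc x) (nclock x) :=
  (init_loc x, [tuple ratr (tnth (init_val x) i) | i < nclock x]).

Definition valid (x : instance) : Prop :=
  [/\ is_stg (game x) (instance_measures x),
      is_state (game x) (init_state x),
      0 <= time_bound x &
      0 < threshold x < 1].

Definition yes_instance (x : instance) : Prop :=
  diamond_wins (game x) (instance_measures x) (init_state x) (target x)
    (ratr (time_bound x)) (threshold_rel x) (ratr (threshold x)).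

(* [M] answers correctly, with 1 or 0, on every valid
   instance with at least [c] clocks; nothing is required on other inputs. *)
Definition decides_from (c : nat) (M : seq instr) : Prop :=
  forall x, valid x -> (c <= nclock x)%N ->
    (yes_instance x -> computes M (code x) 1) /\
    (~ yes_instance x -> computes M (code x) 0).

End Problem.

(* Main.v *)
(* Let a register machine [M] decide the problem. The machine [diag_machine]
   computes, from a number [c], the code of the instance whose game part has
   code [c] and whose first clock starts at [2^-c], runs [M] on it, and halts
   iff the answer is 0. We construct one fixed game in which, started with the
   first clock at [2^-c], Diamond wins iff this machine halts on input [c].
   Taking for [c] the code of the game itself gives a contradiction; no
   universal machine is needed.

   In the game Diamond simulates the machine. A register is stored as two
   quantities that only ever get halved (see [qprog_of]), each being the
   difference of two clocks, so that the whole simulation takes bounded time.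
   After each move of Diamond, Box may check a linear inequality
   [0 <= balance] between the quantities. A check draws a uniform delay from
   an interval that is divided into windows, one for each clock involved, and
   is passed with probability exactly [1/2 + balance / length]. Hence Diamond
   reaches the target with probability at least [1/2] iff every step of the
   simulation is correct and the machine halts. Every play involves at most
   one random draw, so the law of a play is the image of a uniform law. *)
From HB Require Import structures.
Require Import Defs.
From mathcomp Require Import all_boot all_order all_algebra.
From mathcomp Require Import all_classical all_reals all_analysis.
From mathcomp Require Import measurable_realfun zify ring lra.

Set Implicit Arguments.
Unset Strict Implicit.
Unset Printing Implicit Defensive.

(** * Register machines *)

(** The bounded duration is what shapes the encoding. Writing a quantity takes as long as its new
    value, and halving [q] takes two writes of [q / 2], so the cost [q] is exactly what twice the
    sum of all quantities loses. This potential bounds the length of every correct play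
    independently of the number of machine steps, and it is why a decrement halves a second quantity
    instead of doubling the first. A difference of two clocks is unaffected by the time spent on
    other writes. For a quantity [x - y], the clock windows have lengths [x] and [K - y], with sum
    [K + (x - y)]; averaging over windows of length [K] gives the constant 1/2. The self-reference
    works because [c] occurs in the code of an instance only as the game part and in one clock
    value, so that this code is an explicit tower of exponentials in [c]. The two directions need
    different probability. To win, Diamond must exhibit a law of the play against each Box strategy;
    to show that Diamond loses, a bound must hold for every law induced by one Box strategy. The
    first is an image law, the second uses only that the play before the draw is almost surely
    deterministic. *)

Inductive prog := PInc (r : nat) | PLoop (r : nat) (P : prog) | PSeq (P1 P2 : prog).

Fixpoint plen (P : prog) : nat :=
  match P with
  | PInc _ => 1
  | PLoop _ P => (plen P).+2
  | PSeq P1 P2 => plen P1 + plen P2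
  end.

Fixpoint regs_below (z : nat) (P : prog) : bool :=
  match P with
  | PInc r => r < z
  | PLoop r P => (r < z) && regs_below z P
  | PSeq P1 P2 => regs_below z P1 && regs_below z P2
  end.

(* Register [z] is kept at 0, so [JzDec z b] is an unconditional jump to [b]. *)
Fixpoint compile (z b : nat) (P : prog) : seq instr :=
  match P with
  | PInc r => [:: Inc r]
  | PLoop r P => JzDec r (b + (plen P).+2) :: compile z b.+1 P ++ [:: JzDec z b]
  | PSeq P1 P2 => compile z b P1 ++ compile z (b + plen P1) P2
  end.

Lemma size_compile z b P : size (compile z b P) = plen P.
Proof.
elim: P b => //= [r P IH|P1 IH1 P2 IH2] b.
  by rewrite size_cat IH addn1.
by rewrite size_cat IH1 IH2.
Qed.

Definition instr_reg (i : instr) : nat := match i with Inc r => r | JzDec r _ => r end.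

Lemma compile_regs z b P : regs_below z P ->
  all (fun i => instr_reg i < z.+1) (compile z b P).
Proof.
elim: P b => //= [r|r P IH|P1 IH1 P2 IH2] b.
- by rewrite andbT => /ltnW.
- by move=> /andP[/ltnW rz zP]; rewrite all_cat IH //= ltnSn !ltnS andbT rz.
- by move=> /andP[zP1 zP2]; rewrite all_cat IH1 // IH2.
Qed.

Inductive bigstep : prog -> seq nat -> seq nat -> Prop :=
| bs_inc r s : bigstep (PInc r) s (set_nth 0 s r (nth 0 s r).+1)
| bs_loop0 r P s : nth 0 s r = 0 -> bigstep (PLoop r P) s s
| bs_loopS r P s s' s'' n : nth 0 s r = n.+1 ->
    bigstep P (set_nth 0 s r n) s' -> bigstep (PLoop r P) s' s'' ->
    bigstep (PLoop r P) s s''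
| bs_seq P1 P2 s s' s'' : bigstep P1 s s' -> bigstep P2 s' s'' ->
    bigstep (PSeq P1 P2) s s''.

Lemma set_reg_nth s r v : set_reg (nth 0 s) r v = nth 0 (set_nth 0 s r v).
Proof. by apply/funext => i; rewrite /set_reg nth_set_nth. Qed.

Definition reaches (Q : seq instr) (c c' : config) : Prop :=
  exists j, iter j (machine_step Q) c = c'.

Lemma reaches_trans Q c1 c2 c3 : reaches Q c1 c2 -> reaches Q c2 c3 -> reaches Q c1 c3.
Proof. by move=> [i <-] [j <-]; exists (j + i); rewrite iterD. Qed.

Lemma reaches_step Q c c' : machine_step Q c = c' -> reaches Q c c'.
Proof. by move=> <-; exists 1. Qed.

Lemma nth_mid (A C D : seq instr) i : i < size C ->
  nth (Inc 0) (A ++ C ++ D) (size A + i) = nth (Inc 0) C i.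
Proof.
move=> iC; rewrite nth_cat ltnNge leq_addr /= addKn.
by rewrite nth_cat iC.
Qed.

(** The surrounding code [A] and [D] is arbitrary so that the induction can place subprograms
    anywhere. That register [z] stays 0 is part of the induction, since only then does a loop jump
    back unconditionally. *)
Lemma compile_correct z P s s' A D : bigstep P s s' -> regs_below z P ->
  nth 0 s z = 0 ->
  nth 0 s' z = 0 /\
  reaches (A ++ compile z (size A) P ++ D) (size A, nth 0 s)
          (size A + plen P, nth 0 s').
Proof.
move=> h; elim: h A D => {P s s'}.
- move=> r s A D /= rz sz0; split.
    by rewrite nth_set_nth /=; case: eqP => // ?; lia.
  apply: reaches_step; rewrite /machine_step size_cat /= ifT; last by lia.
  by rewrite nth_cat ltnn subnn /= set_reg_nth addn1.
- move=> r P s sr0 A D /= /andP[rz zP] sz0; split=> //.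
  apply: reaches_step; rewrite /machine_step size_cat /= ifT; last by lia.
  by rewrite nth_cat ltnn subnn /= sr0 eqxx.
- move=> r P s s' s'' n srn _ IH1 _ IH2 A D zL sz0.
  have /= /andP[rz zP] := zL.
  set Q := (X in reaches X).
  have [|s'z r1] := IH1 (rcons A (JzDec r (size A + (plen P).+2)))
    (JzDec z (size A) :: D) zP.
    by rewrite nth_set_nth /=; case: eqP => // ?; lia.
  have [s''z r2] := IH2 A D zL s'z; split=> //.
  apply: reaches_trans r2.
  have e1 : Q = rcons A (JzDec r (size A + (plen P).+2)) ++
      compile z (size A).+1 P ++ JzDec z (size A) :: D.
    by rewrite /Q /= cat_rcons -catA.
  apply: (reaches_trans (c2 := ((size A).+1, nth 0 (set_nth 0 s r n)))).
    apply: reaches_step; rewrite /machine_step ifT; last first.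
      by rewrite /Q size_cat /=; lia.
    by rewrite /Q nth_cat ltnn subnn /= srn /= -set_reg_nth.
  rewrite size_rcons -e1 in r1; apply: (reaches_trans r1).
  apply: reaches_step; rewrite /machine_step ifT; last first.
    by rewrite e1 size_cat size_rcons size_cat size_compile /=; lia.
  rewrite e1 nth_cat size_rcons ifF; last by lia.
  rewrite nth_cat size_compile ifF; last by lia.
  by rewrite (_ : _ - _ - _ = 0) /= ?s'z //; lia.
- move=> P1 P2 s s' s'' _ IH1 _ IH2 A D /= /andP[zP1 zP2] sz0.
  have [s'z r1] := IH1 A (compile z (size A + plen P1) P2 ++ D) zP1 sz0.
  have [s''z] := IH2 (A ++ compile z (size A) P1) D zP2 s'z.
  rewrite size_cat size_compile => r2; split=> //.
  rewrite -!catA in r1 r2 *; rewrite addnA.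
  exact: reaches_trans r2.
Qed.

(** * Computing codes *)

Definition dbl := PSeq (PLoop 0 (PSeq (PInc 2) (PInc 2))) (PLoop 2 (PInc 0)).
Definition shl := PLoop 1 dbl.
(** The base case stands for the empty program: a loop on register 2 does nothing while that
    register is 0, and the programs below always leave it at 0. *)
Fixpoint incn r n := if n is n'.+1 then PSeq (PInc r) (incn r n') else PLoop 2 (PInc 2).
(** Replaces [x] in register 0 by [2 ^ x * C], the form of the code of a pair whose second component
    is fixed. *)
Definition pow C := PSeq (PLoop 0 (PInc 1)) (PSeq (incn 0 C) shl).

Lemma incn_correct0 n x y c : bigstep (incn 0 n) [:: x; y; 0; c] [:: x + n; y; 0; c].
Proof.
elim: n x => [|n IH] x /=; first by rewrite addn0; exact: bs_loop0.
apply: bs_seq; first exact: bs_inc.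
by rewrite /= addnS -addSn; exact: IH.
Qed.

Lemma incn_correct1 n x y c : bigstep (incn 1 n) [:: x; y; 0; c] [:: x; y + n; 0; c].
Proof.
elim: n y => [|n IH] y /=; first by rewrite addn0; exact: bs_loop0.
apply: bs_seq; first exact: bs_inc.
by rewrite /= addnS -addSn; exact: IH.
Qed.

Lemma dbl_correct x y c : bigstep dbl [:: x; y; 0; c] [:: x * 2; y; 0; c].
Proof.
apply: (bs_seq (s' := [:: 0; y; x * 2; c])).
  suff H t : bigstep (PLoop 0 (PSeq (PInc 2) (PInc 2))) [:: x; y; t; c]
    [:: 0; y; t + x * 2; c] by exact: H.
  elim: x t => [|x IH] t; first by rewrite mul0n addn0; exact: bs_loop0.
  apply: (bs_loopS (n := x)) => //=.
    by apply: bs_seq; exact: bs_inc.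
  by rewrite /= mulSn !addnS -!addSn; exact: IH.
suff H n t : bigstep (PLoop 2 (PInc 0)) [:: t; y; n; c] [:: t + n; y; 0; c].
  exact: (H (x * 2) 0).
elim: n t => [|n IH] t; first by rewrite addn0; exact: bs_loop0.
apply: (bs_loopS (n := n)) => //=; first exact: bs_inc.
by rewrite /= addnS -addSn; exact: IH.
Qed.

Lemma shl_correct x y c : bigstep shl [:: x; y; 0; c] [:: x * 2 ^ y; 0; 0; c].
Proof.
elim: y x => [|y IH] x; first by rewrite muln1; exact: bs_loop0.
apply: (bs_loopS (n := y)) => //=; first exact: dbl_correct.
by rewrite expnS mulnA; exact: IH.
Qed.

Lemma pow_correct C x c : bigstep (pow C) [:: x; 0; 0; c] [:: 2 ^ x * C; 0; 0; c].
Proof.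
apply: (bs_seq (s' := [:: 0; x; 0; c])).
  suff H t : bigstep (PLoop 0 (PInc 1)) [:: x; t; 0; c] [:: 0; t + x; 0; c] by exact: H.
  elim: x t => [|x IH] t; first by rewrite addn0; exact: bs_loop0.
  apply: (bs_loopS (n := x)) => //=; first exact: bs_inc.
  by rewrite /= addnS -addSn; exact: IH.
apply: bs_seq; first exact: incn_correct0.
by rewrite mulnC; exact: shl_correct.
Qed.

(* The code of an instance whose game part has code [c] and whose first
   initial clock value is [2^-c]: [C0] is the code of the integer 1, and the odd
   numbers [C1, .., C4] stand for the components other than that value. *)
Definition diag_code (C0 C1 C2 C3 C4 c : nat) : nat :=
  let den := 2 ^ 2 ^ 2 ^ c * 3 in
  let init := 2 ^ (2 ^ C0 * (2 ^ den).*2.+1) * C1 in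
  2 ^ (2 ^ (2 ^ (2 ^ c * (2 ^ init).*2.+1) * C2) * C3) * C4.

Definition copy0 := PSeq (PLoop 0 (PSeq (PInc 1) (PInc 3))) (PLoop 1 (PInc 0)).

(** Register 0 holds the number built so far, from the innermost exponent outwards; register 3 keeps
    the copy of [c] that is needed again for the game part. [pow 2] and [PInc 0] give
    [(2 ^ x).*2.+1], the second factor of the code of a pair, and [shl] supplies the first
    factor. *)
Definition diag_prog (C0 C1 C2 C3 C4 : nat) : prog :=
  foldr PSeq (pow C4)
    [:: copy0; pow 1; pow 1; pow 3; pow 2; PInc 0; incn 1 C0; shl; pow C1;
        pow 2; PInc 0; PLoop 3 (PInc 1); shl; pow C2; pow C3].

Lemma copy0_correct c : bigstep copy0 [:: c; 0; 0; 0] [:: c; 0; 0; c].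
Proof.
apply: (bs_seq (s' := [:: 0; c; 0; c])).
  suff H t : bigstep (PLoop 0 (PSeq (PInc 1) (PInc 3))) [:: c; t; 0; t]
    [:: 0; t + c; 0; t + c] by exact: H.
  elim: c t => [|c IH] t; first by rewrite addn0; exact: bs_loop0.
  apply: (bs_loopS (n := c)) => //=.
    by apply: bs_seq; exact: bs_inc.
  by rewrite /= addnS -addSn; exact: IH.
suff H n t : bigstep (PLoop 1 (PInc 0)) [:: t; n; 0; c] [:: t + n; 0; 0; c] by exact: H.
elim: n t => [|n IH] t; first by rewrite addn0; exact: bs_loop0.
apply: (bs_loopS (n := n)) => //=; first exact: bs_inc.
by rewrite /= addnS -addSn; exact: IH.
Qed.

Lemma move31_correct x c :
  bigstep (PLoop 3 (PInc 1)) [:: x; 0; 0; c] [:: x; c; 0; 0].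
Proof.
suff H t : bigstep (PLoop 3 (PInc 1)) [:: x; t; 0; c] [:: x; t + c; 0; 0] by exact: H.
elim: c t => [|c IH] t; first by rewrite addn0; exact: bs_loop0.
apply: (bs_loopS (n := c)) => //=; first exact: bs_inc.
by rewrite /= addnS -addSn; exact: IH.
Qed.

Lemma pow2_correct x c :
  bigstep (PSeq (pow 2) (PInc 0)) [:: x; 0; 0; c] [:: (2 ^ x).*2.+1; 0; 0; c].
Proof.
by apply: bs_seq; [exact: pow_correct | rewrite -muln2; exact: bs_inc].
Qed.

(** The program is folded to the right, whereas [pow 2] and [PInc 0] are verified as one block. *)
Lemma bs_assoc P1 P2 P3 s s' s'' : bigstep (PSeq P1 P2) s s' ->
  bigstep P3 s' s'' -> bigstep (PSeq P1 (PSeq P2 P3)) s s''.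
Proof.
move=> h h3; inversion h; subst; apply: bs_seq; first eassumption.
by apply: bs_seq; eassumption.
Qed.

Lemma diag_prog_correct C0 C1 C2 C3 C4 c :
  bigstep (diag_prog C0 C1 C2 C3 C4) [:: c; 0; 0; 0]
    [:: diag_code C0 C1 C2 C3 C4 c; 0; 0; 0].
Proof.
rewrite /diag_prog /diag_code /=.
apply: bs_seq; first exact: copy0_correct.
do 3! (apply: bs_seq; first exact: pow_correct).
rewrite !muln1.
apply: bs_assoc; first exact: pow2_correct.
apply: bs_seq; first exact: incn_correct1.
apply: bs_seq; first exact: shl_correct.
rewrite add0n [_.+1 * _]mulnC.
apply: bs_seq; first exact: pow_correct.
apply: bs_assoc; first exact: pow2_correct.
apply: bs_seq; first exact: move31_correct.
apply: bs_seq; first exact: shl_correct.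
rewrite [_.+1 * 2 ^ c]mulnC.
do 2! (apply: bs_seq; first exact: pow_correct).
exact: pow_correct.
Qed.

Lemma regs_below_incn z r n : 2 < z -> r < z -> regs_below z (incn r n).
Proof. by move=> z2 rz; elim: n => //= [|n ->]; rewrite ?z2 ?rz. Qed.

Lemma regs_below_diag z C0 C1 C2 C3 C4 : 3 < z -> regs_below z (diag_prog C0 C1 C2 C3 C4).
Proof.
move=> z3; have [z0 z1 z2] : [/\ 0 < z, 1 < z & 2 < z] by split; lia.
by rewrite /= ?regs_below_incn // z0 z1 z2 z3.
Qed.

(** * Embedding a machine into a larger one; the diagonal machine *)

Definition halts (Q : seq instr) (f : nat -> nat) : Prop :=
  exists j, size Q <= (iter j (machine_step Q) (0, f)).1.

Lemma halted_later Q c i k : size Q <= (iter i (machine_step Q) c).1 ->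
  size Q <= (iter (k + i) (machine_step Q) c).1.
Proof.
rewrite iterD; case: (iter i _ _) => pc f /= h.
elim: k => // k; rewrite iterS; case: (iter k _ _) => pc' f' h'.
by rewrite /machine_step ltnNge h'.
Qed.

(** Jump targets beyond the end are clipped, so every way of leaving [M] arrives at the instruction
    right behind the copy. *)
Definition relocate_instr (n b : nat) (i : instr) : instr :=
  match i with Inc r => Inc r | JzDec r q => JzDec r (b + minn q n) end.

Definition relocate (b : nat) (M : seq instr) : seq instr :=
  map (relocate_instr (size M) b) M.

Lemma relocate_step A M D pc f : pc < size M ->
  let c := machine_step M (pc, f) in
  machine_step (A ++ relocate (size A) M ++ D) (size A + minn pc (size M), f) =
  (size A + minn c.1 (size M), c.2).
Proof.
move=> pcM /=; rewrite pcM ifT; last first.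
  by rewrite !size_cat size_map; lia.
rewrite (minn_idPl (ltnW pcM)) nth_mid ?size_map // (nth_map (Inc 0)) //.
case: (nth _ _ _) => [r|r q] /=; first by rewrite (minn_idPl pcM) addnS.
by case: ifP => // _; rewrite (minn_idPl pcM) addnS.
Qed.

Lemma relocate_reaches A M D pc f j :
  let c := iter j (machine_step M) (pc, f) in
  reaches (A ++ relocate (size A) M ++ D) (size A + minn pc (size M), f)
    (size A + minn c.1 (size M), c.2).
Proof.
elim: j => [|j IH] /=; first by exists 0.
move: IH; case: (iter _ _ _) => pc' f' /= IH.
apply: reaches_trans IH _; case: (ltnP pc' (size M)) => h; last first.
  by rewrite (minn_idPr h); exists 0.
apply: reaches_step.
have := relocate_step A D f' h; rewrite (minn_idPl (ltnW h)) => ->.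
by rewrite /= h.
Qed.

Definition instrs_below (z : nat) (M : seq instr) := all (fun i => instr_reg i < z) M.

Lemma step_untouched z M c : instrs_below z M ->
  (machine_step M c).2 z = c.2 z.
Proof.
case: c => pc f /(all_nthP (Inc 0)) h /=; case: ifP => //= pcM.
have := h _ pcM; case: (nth _ _ _) => [r|r q] /= rz; first by rewrite /set_reg;
  case: eqP => //; lia.
by case: ifP => //= _; rewrite /set_reg; case: eqP => //; lia.
Qed.

Lemma iter_untouched z M c j : instrs_below z M ->
  (iter j (machine_step M) c).2 z = c.2 z.
Proof. by move=> h; elim: j => //= j <-; exact: step_untouched. Qed.

(* Simulates [M] on the code of the instance built from the input, and halts
   exactly if the answer is 0. *)
Definition diag_machine (z : nat) (M : seq instr) (C0 C1 C2 C3 C4 : nat) : seq instr :=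
  let F := compile z 0 (diag_prog C0 C1 C2 C3 C4) in
  let b := size F + size M in
  F ++ relocate (size F) M ++ [:: JzDec 0 b.+2; JzDec z b.+1].

Section DiagMachine.
Variables (z : nat) (M : seq instr) (C0 C1 C2 C3 C4 : nat).
Hypotheses (z3 : 3 < z) (zM : instrs_below z M).

Let Q := diag_machine z M C0 C1 C2 C3 C4.

Lemma diag_machine_below : instrs_below z.+1 Q.
Proof.
rewrite /Q /diag_machine /instrs_below 2!all_cat compile_regs; last exact: regs_below_diag.
rewrite andTb; apply/andP; split; last by rewrite /= ltnSn.
rewrite /relocate all_map; move: zM.
by rewrite /instrs_below; apply: sub_all => -[r|r q] /=; apply: ltnW.
Qed.

Let F := compile z 0 (diag_prog C0 C1 C2 C3 C4).
Let b := size F + size M.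

Lemma size_diag_machine : size Q = b.+2.
Proof. by rewrite /Q /diag_machine 2!size_cat size_map -/F -addn2 addnA. Qed.

Lemma nth_diag_machine i :
  nth (Inc 0) Q (b + i) = nth (Inc 0) [:: JzDec 0 b.+2; JzDec z b.+1] i.
Proof.
by rewrite /Q /diag_machine catA nth_cat size_cat size_map -/F -/b ltnNge leq_addr addKn.
Qed.

(** The coding program leaves all registers but 0 empty, so [M] starts as [computes] demands.
    Register [z] is beyond those of [M] and is still 0 afterwards. *)
Lemma diag_machine_answer c y :
  computes M (diag_code C0 C1 C2 C3 C4 c) y ->
  exists f, [/\ f 0 = y, f z = 0 & reaches Q (0, set_reg (fun=> 0) 0 c) (b, f)].
Proof.
move=> [j]; set d := diag_code _ _ _ _ _ c.
set c' := iter _ _ _; case E : c' => [pc f] [/= hM <-].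
exists f; split=> //.
  rewrite -[f]/((pc, f).2) -E iter_untouched //= /set_reg.
  by case: eqP => //; lia.
have h0 : nth 0 [:: c; 0; 0; 0] z = 0 by rewrite nth_default.
have := compile_correct [::] (relocate (size F) M ++ [:: JzDec 0 b.+2; JzDec z b.+1])
  (diag_prog_correct C0 C1 C2 C3 C4 c) (regs_below_diag C0 C1 C2 C3 C4 z3) h0.
move=> [_ r1].
have eqreg x : nth 0 [:: x; 0; 0; 0] = set_reg (fun=> 0) 0 x.
  by apply/funext => -[|[|[|[|i]]]] //=; rewrite /set_reg /= nth_nil.
rewrite !eqreg -(size_compile z 0) add0n -/F in r1.
apply: reaches_trans r1 _.
have := relocate_reaches F M [:: JzDec 0 b.+2; JzDec z b.+1] 0 (set_reg (fun=> 0) 0 d) j.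
by rewrite /= -/c' E min0n addn0 /= (minn_idPr hM).
Qed.

Lemma diag_machine_halts c :
  computes M (diag_code C0 C1 C2 C3 C4 c) 0 -> halts Q (set_reg (fun=> 0) 0 c).
Proof.
move=> /diag_machine_answer[f [f0 fz [j hj]]].
exists j.+1; rewrite iterS hj /machine_step size_diag_machine ltnS leqnSn.
by have := nth_diag_machine 0; rewrite addn0 => ->; rewrite /= f0.
Qed.

(** With 1 in register 0, the first of the two final instructions falls through to the second, which
    jumps to itself because register [z] is 0. *)
Lemma diag_machine_loops c :
  computes M (diag_code C0 C1 C2 C3 C4 c) 1 -> ~ halts Q (set_reg (fun=> 0) 0 c).
Proof.
move=> /diag_machine_answer[f [f0 fz [j hj]]].
set c0 := (0, _) in hj *.
have s1 : machine_step Q (b, f) = (b.+1, set_reg f 0 0).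
  rewrite /machine_step size_diag_machine ltnS leqnSn.
  by have := nth_diag_machine 0; rewrite addn0 => ->; rewrite /= f0.
have s2 : machine_step Q (b.+1, set_reg f 0 0) = (b.+1, set_reg f 0 0).
  rewrite /machine_step size_diag_machine ltnSn.
  have := nth_diag_machine 1; rewrite addn1 => ->.
  have z0 : (z == 0) = false by apply/eqP; lia.
  by rewrite /= {1}/set_reg z0 fz.
have stay i : iter i (machine_step Q) (iter j.+1 (machine_step Q) c0) =
    (b.+1, set_reg f 0 0).
  by rewrite iterS hj s1; elim: i => // i; rewrite iterS => ->; exact: s2.
move=> [i /(halted_later j.+1)]; rewrite -/c0.
by rewrite addnC iterD stay size_diag_machine ltnn.
Qed.

End DiagMachine.

Import Order.TTheory GRing.Theory Num.Theory.
Import numFieldNormedType.Exports.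

Local Open Scope classical_set_scope.
Local Open Scope ring_scope.

(** * Programs that write real quantities *)

(* At a node [x] the quantity [wr x] is overwritten and one of the branches
   enabled by [en] is chosen, which leads to the node [nx x b], or to the goal
   if [nx x b] is [None]. The result is subject to the linear inequalities
   [0 <= balance q t] for [t] in [ts x b]. *)
Definition test := seq (nat * bool).

Record qprog := QProg {
  node : finType;
  wr : node -> nat;
  en : node -> bool -> bool;
  nx : node -> bool -> option node;
  ts : node -> bool -> seq test }.

(** Its balance is 0. It makes all indices beyond a list of tests harmless, and it is the check that
    ends a halted simulation: it succeeds with probability exactly 1/2, which is enough for
    Diamond. *)
Definition trivial_test : test := [:: (0%N, true); (0%N, false)].

Section QProg.
Context (R : realType) (G : qprog).

Definition balance (q : nat -> R) (t : test) : R :=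
  \sum_(p <- t) (if p.2 then q p.1 else - q p.1).

Definition write (q : nat -> R) (i : nat) (d : R) : nat -> R :=
  fun j => if j == i then d else q j.

Definition nth_test (x : node G) (b : bool) (c : nat) : test :=
  nth trivial_test (ts x b) c.

Definition passes (q : nat -> R) (x : node G) (b : bool) : Prop :=
  forall c : nat, 0 <= balance q (nth_test x b c).

Fixpoint play (x : node G) (q : nat -> R) (l : seq (R * bool)) : Prop :=
  if l is (d, b) :: l' then
    let q' := write q (wr x) d in
    [/\ 0 <= d, en x b, passes q' x b &
        if nx x b is Some x' then play x' q' l' else l' = [::]]
  else False.

End QProg.

(** * Register machines as such programs *)

(* Register [r] is represented by the quantities [2r] and [2r+1], with values
   [2^-i] and [2^-d] where [i - d] is the value of the register: thus an
   increment halves the first one, a decrement halves the second one, and the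
   register is zero iff they are equal. Halving goes through the quantity
   [2nr], so that old and new values can be compared. *)
Section Compile.
Variables (nr : nat) (Q : seq instr).

(** The flag is the phase of an instruction: [false] writes the temporary quantity and chooses the
    branch, [true] copies the temporary quantity to its destination. *)
Definition mnode : Type := 'I_(size Q).-1.+1 * bool.
Definition at_pc (pc : nat) : option mnode :=
  if (pc < size Q)%N then Some (inord pc, false) else None.
Definition instr_at (x : mnode) : instr := nth (Inc 0) Q x.1.

Definition changed (i : instr) : nat :=
  match i with Inc r => r.*2 | JzDec r _ => r.*2.+1 end.

Definition eq_tests (i j : nat) : seq test :=
  [:: [:: (i, true); (j, false)]; [:: (j, true); (i, false)]].
Definition half_tests (i j : nat) : seq test :=
  [:: [:: (i, true); (i, true); (j, false)]; [:: (i, false); (i, false); (j, true)]].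

Definition mwr (x : mnode) : nat := if x.2 then changed (instr_at x) else nr.*2.
Definition men (x : mnode) (b : bool) : bool :=
  b ==> (if instr_at x is JzDec _ _ then ~~ x.2 else false).
Definition mnx (x : mnode) (b : bool) : option mnode :=
  if x.2 then at_pc x.1.+1 else
  if b then (if instr_at x is JzDec _ q then at_pc q else None)
  else Some (x.1, true).
(** Only non-strict inequalities can be checked, so an equality takes two tests. That a register is
    nonzero is strict, but it becomes non-strict through the gap between powers of 1/2:
    [2^-(f+d) <= 2^-(d+1)] iff [1 <= f], and the right-hand side is the temporary quantity. *)
Definition mts (x : mnode) (b : bool) : seq test :=
  if x.2 then eq_tests (changed (instr_at x)) nr.*2 else
  match instr_at x with
  | Inc r => half_tests nr.*2 r.*2
  | JzDec r _ => if b then eq_tests r.*2 r.*2.+1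
                 else rcons (half_tests nr.*2 r.*2.+1) [:: (nr.*2, true); (r.*2, false)]
  end.

Definition qprog_of : qprog :=
  @QProg (Finite.clone mnode _) mwr men mnx mts.

Context (R : realType).
Hypothesis (Qnr : instrs_below nr Q) (Q0 : (0 < size Q)%N).

Lemma passes_eq (q : nat -> R) (x : node qprog_of) b i j :
  mts x b = eq_tests i j -> passes q x b <-> q i = q j.
Proof.
move=> E; rewrite /passes /nth_test /= E; split=> [h|h c].
  have := h 0%N; have := h 1%N; rewrite /balance /= !big_cons !big_nil /=; lra.
case: c => [|[|[|c]]]; rewrite /balance /= ?nth_nil !big_cons !big_nil /=; lra.
Qed.

Lemma passes_half (q : nat -> R) (x : node qprog_of) b i j :
  mts x b = half_tests i j -> passes q x b <-> q i = q j / 2.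
Proof.
move=> E; rewrite /passes /nth_test /= E; split=> [h|h c].
  have := h 0%N; have := h 1%N; rewrite /balance /= !big_cons !big_nil /=; lra.
case: c => [|[|[|c]]]; rewrite /balance /= ?nth_nil !big_cons !big_nil /=; lra.
Qed.

Lemma passes_dec (q : nat -> R) (x : node qprog_of) b i j k :
  mts x b = rcons (half_tests i j) [:: (i, true); (k, false)] ->
  passes q x b <-> q i = q j / 2 /\ q k <= q i.
Proof.
move=> E; rewrite /passes /nth_test /= E; split=> [h|h c].
  have := h 0%N; have := h 1%N; have := h 2%N.
  rewrite /balance /= !big_cons !big_nil /=; lra.
case: c => [|[|[|c]]]; rewrite /balance /= ?nth_nil !big_cons !big_nil /=; lra.
Qed.

Local Notation hp n := ((2^-1 : R) ^+ n).

Definition represents (q : nat -> R) (f : nat -> nat) : Prop :=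
  exists ds : nat -> nat, forall r, (r < nr)%N ->
    q r.*2 = hp (f r + ds r) /\ q r.*2.+1 = hp (ds r).

Lemma hpS n : hp n.+1 = hp n / 2.
Proof. by rewrite exprS mulrC. Qed.

Lemma hp_le i j : (hp i <= hp j) = (j <= i)%N.
Proof. by rewrite ler_iXn2l //; lra. Qed.

Lemma hp_inj i j : hp i = hp j -> i = j.
Proof.
move=> h; apply/eqP; rewrite eqn_leq -!hp_le.
by rewrite h lexx.
Qed.

Lemma mnode_lt (x : mnode) : (x.1 < size Q)%N.
Proof. by apply: leq_trans (ltn_ord x.1) _; rewrite prednK. Qed.

Lemma instr_at_reg (x : mnode) r : instr_reg (instr_at x) = r -> (r < nr)%N.
Proof.
move=> <-; rewrite /instr_at; move/(all_nthP (Inc 0)): Qnr => -> //.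
exact: mnode_lt.
Qed.

Lemma changed_lt (x : mnode) : (changed (instr_at x) < nr.*2)%N.
Proof.
have := @instr_at_reg x _ erefl.
by case: (instr_at x) => [r|r q] /=; lia.
Qed.

Variable f0 : nat -> nat.

(** In the second phase the configuration is still the one before the instruction; what the tests of
    the first phase have established is recorded separately. *)
Definition tracks (x : mnode) (q : nat -> R) : Prop :=
  exists j f, [/\ iter j (machine_step Q) (0%N, f0) = (x.1 : nat, f),
    represents q f &
    x.2 -> q nr.*2 = q (changed (instr_at x)) / 2 /\
           (if instr_at x is JzDec r _ then (0 < f r)%N else true)].

Lemma represents_write_temp q f d : represents q f -> represents (write q nr.*2 d) f.
Proof.
move=> [ds h]; exists ds => r rnr; have [h1 h2] := h r rnr.
by rewrite /write !ifF //; apply/eqP; lia.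
Qed.

Lemma represents_inc q f r : represents q f -> (r < nr)%N ->
  represents (write q r.*2 (q r.*2 / 2)) (set_reg f r (f r).+1).
Proof.
move=> [ds h] rnr; exists ds => r' r'nr; have [h1 h2] := h r' r'nr.
rewrite /write /set_reg; case: (eqVneq r' r) => [e|ne].
  by rewrite e eqxx in h1 h2 *; rewrite ifF ?h1 ?addSn ?hpS //; apply/eqP; lia.
by rewrite !ifF //; apply/eqP; lia.
Qed.

Lemma represents_dec q f r : represents q f -> (r < nr)%N -> (0 < f r)%N ->
  represents (write q r.*2.+1 (q r.*2.+1 / 2)) (set_reg f r (f r).-1).
Proof.
move=> [ds h] rnr fr; exists (set_reg ds r (ds r).+1) => r' r'nr.
have [h1 h2] := h r' r'nr.
rewrite /write /set_reg; case: (eqVneq r' r) => [e|ne].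
  rewrite e eqxx in h1 h2 *; rewrite ifF ?h1 ?h2 ?hpS; last by apply/eqP; lia.
  by split=> //; congr (_ ^+ _); lia.
by rewrite !ifF //; apply/eqP; lia.
Qed.

Lemma step_at j (x : mnode) f : iter j (machine_step Q) (0%N, f0) = (x.1 : nat, f) ->
  iter j.+1 (machine_step Q) (0%N, f0) =
  match instr_at x with
  | Inc r => (x.1.+1, set_reg f r (f r).+1)
  | JzDec r q => if f r == 0%N then (q, f) else (x.1.+1, set_reg f r (f r).-1)
  end.
Proof. by move=> h; rewrite iterS h /= mnode_lt. Qed.

Lemma tracks_at_pc j pc f q : iter j (machine_step Q) (0%N, f0) = (pc, f) ->
  represents q f ->
  if at_pc pc is Some x' then tracks x' q else halts Q f0.
Proof.
move=> hj hq; rewrite /at_pc; case: ltnP => pcQ; last by exists j; rewrite hj.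
exists j, f; split=> //=; rewrite inordK //; by rewrite prednK.
Qed.

(** Soundness against a cheating Diamond: the tests determine [d] wherever its value matters, and
    they force the branch that agrees with the register, because different exponents give different
    powers of 1/2. *)
Lemma tracks_step (x : node qprog_of) (q : nat -> R) (d : R) (b : bool) :
  tracks x q -> men x b -> passes (write q (mwr x) d) x b ->
  if mnx x b is Some x' then tracks x' (write q (mwr x) d) else halts Q f0.
Proof.
move=> [j [f [hj hq ht]]].
have hj' := step_at hj.
have rnr := @instr_at_reg x; have clt := changed_lt x.
have wq d' k : (k < nr.*2)%N -> write q nr.*2 d' k = q k.
  by move=> h; rewrite /write ifF //; apply/eqP; lia.
have wt d' : write q nr.*2 d' nr.*2 = d' by rewrite /write eqxx.
rewrite /men /mnx /mwr; case ph: x.2 ht => ht hen hp.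
  have [ht1 ht2] := ht isT.
  have e : d = q (changed (instr_at x)) / 2.
    have [] := @passes_eq (write q (changed (instr_at x)) d) x b (changed (instr_at x)) nr.*2.
      by rewrite /mts ph.
    move=> /(_ hp) + _; rewrite /write eqxx => ->.
    by rewrite ifF //; apply/eqP; lia.
  rewrite {}e; move: ht2 hj' rnr; case: (instr_at x) => [r|r q'] fr hj' rnr /=.
    by apply: tracks_at_pc hj' _; apply: represents_inc hq _; exact: rnr.
  apply: (@tracks_at_pc j.+1 _ (set_reg f r (f r).-1)).
    by rewrite hj' ifF //; apply/eqP; lia.
  by apply: represents_dec hq _ fr; exact: rnr.
case E : (instr_at x) hj' rnr hen clt => [r|r q'] hj' rnr hen clt /=.
  case: b hen hp => // _ hp.
  exists j, f; split=> //=; first exact: represents_write_temp.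
  move=> _; rewrite /instr_at /= -/(instr_at x) E /=; split=> //.
  have [] := @passes_half (write q nr.*2 d) x false nr.*2 r.*2.
    by rewrite /mts ph E.
  by move=> /(_ hp).
have {}rnr := rnr r erefl.
have [ds h] := hq; have [h1 h2] := h r rnr.
case: b hen hp => _ hp.
  apply: (@tracks_at_pc j.+1 _ f); last exact: represents_write_temp.
  rewrite hj' ifT //; apply/eqP.
  have [] := @passes_eq (write q nr.*2 d) x true r.*2 r.*2.+1.
    by rewrite /mts ph E.
  move=> /(_ hp) + _; rewrite !wq; [|lia|lia].
  by rewrite h1 h2 => /hp_inj; lia.
exists j, f; split=> //=; first exact: represents_write_temp.
move=> _; rewrite /instr_at /= -/(instr_at x) E /=.
have [] := @passes_dec (write q nr.*2 d) x false nr.*2 r.*2.+1 r.*2.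
  by rewrite /mts ph E.
move=> /(_ hp) + _; rewrite wt !wq; [|lia|lia].
move=> [-> hle]; split=> //.
by move: hle; rewrite h1 h2 -hpS hp_le; lia.
Qed.

Lemma sum_write_temp (q : nat -> R) d :
  \sum_(i < nr.*2) write q nr.*2 d i = \sum_(i < nr.*2) q i.
Proof.
apply: eq_bigr => i _; rewrite /write ifF //.
by apply/negbTE; rewrite neq_ltn ltn_ord.
Qed.

Lemma sum_write (q : nat -> R) i d : (i < nr.*2)%N ->
  \sum_(j < nr.*2) write q i d j = \sum_(j < nr.*2) q j - q i + d.
Proof.
move=> h; rewrite (bigD1 (Ordinal h)) //= [in RHS](bigD1 (Ordinal h)) //=.
rewrite /write eqxx [q i + _]addrC addrK addrC; congr (_ + _).
by apply: eq_bigr => j; rewrite -val_eqE /= => /negbTE ->.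
Qed.

Lemma represents_gt0 q f i : represents q f -> (i < nr.*2)%N -> 0 < q i.
Proof.
move=> [ds h] inr; rewrite -(odd_double_half i).
have [|h1 h2] := h i./2; first by lia.
by case: odd; rewrite ?add1n ?add0n ?h1 ?h2; apply: exprn_gt0; lra.
Qed.

(** The bound does not involve [k]: it is the potential that pays for every remaining write. *)
Lemma play_exists k pc f q : represents q f ->
  (size Q <= (iter k (machine_step Q) (pc, f)).1)%N ->
  exists l : seq (R * bool),
    (if at_pc pc is Some x then @play R qprog_of x q l else l = [::]) /\
    \sum_(p <- l) p.1 <= 2 * \sum_(i < nr.*2) q i.
Proof.
elim: k pc f q => [|k IH] pc f q hq.
  move=> h; exists [::]; rewrite big_nil /at_pc ltnNge h /=; split=> //.
  by apply: mulr_ge0 => //; apply: sumr_ge0 => i _; apply/ltW/(represents_gt0 hq).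
rewrite iterSr /at_pc; case: ltnP => pcQ h; last first.
  exists [::]; rewrite big_nil; split=> //.
  by apply: mulr_ge0 => //; apply: sumr_ge0 => i _; apply/ltW/(represents_gt0 hq).
pose x : mnode := (inord pc, false); rewrite -/x.
have xpc : pc = x.1 by rewrite /= inordK // prednK.
have rnr := @instr_at_reg x; have clt := changed_lt x.
move: h; rewrite /machine_step pcQ {1}xpc -/(instr_at x) -/(machine_step Q).
have wq (q' : nat -> R) d' j : (j < nr.*2)%N -> write q' nr.*2 d' j = q' j.
  by move=> h; rewrite /write ifF //; apply/eqP; lia.
have [ds h] := hq.
have halve f' : men x false ->
    (let s := changed (instr_at x) in
    passes (write q nr.*2 (q s / 2)) (x : node qprog_of) false) ->
    represents (write q (changed (instr_at x)) (q (changed (instr_at x)) / 2)) f' ->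
    (size Q <= (iter k (machine_step Q) (pc.+1, f')).1)%N ->
  exists l : seq (R * bool), @play R qprog_of x q l /\
    \sum_(p <- l) p.1 <= 2 * \sum_(i < nr.*2) q i.
  set s := changed _ => hen /= hp hq' /(IH _ _ (write (write q nr.*2 (q s / 2)) s (q s / 2))).
  have s0 := represents_gt0 hq clt.
  case=> [|l [hl sl]].
    have [ds' h'] := hq'; exists ds' => r rr; have [h1 h2] := h' r rr.
    by rewrite -h1 -h2 /write; split; do 2 (case: eqP => //); lia.
  (* The two writes cost [q s] in total, and twice the sum decreases by exactly this amount. *)
  exists ((q s / 2, false) :: (q s / 2, false) :: l); split; last first.
    rewrite !big_cons /= sum_write // sum_write_temp wq // in sl *.
    move: sl; set S := \sum_(i < _) _; lra.
  have d0 : 0 <= q s / 2 by lra.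
  split => //=; split=> //.
    rewrite /mwr /= /instr_at /= -/(instr_at x) -/s.
    apply/(@passes_eq _ _ _ s nr.*2); first by rewrite /mts /= /instr_at /= -/(instr_at x).
    by rewrite /write eqxx ifF ?eqxx //; apply/eqP; lia.
  rewrite /mnx /= /mwr /= {1}/instr_at /= -/(instr_at x) -/s.
  by rewrite -xpc.
case E : (instr_at x) => [r|r q'].
  apply: halve; rewrite /men E //=.
    apply/(@passes_half _ _ _ nr.*2 r.*2); first by rewrite /mts E.
    by rewrite /write eqxx ifF //; apply/eqP; have := rnr r; rewrite E => /(_ erefl); lia.
  by apply: represents_inc; rewrite // rnr // E.
have {}rnr : (r < nr)%N by rewrite rnr // E.
have [h1 h2] := h r rnr.
case: eqP => fr; last first.
  apply: halve; rewrite /men E //=.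
    apply/(@passes_dec _ _ _ nr.*2 r.*2.+1 r.*2); first by rewrite /mts E.
    rewrite (wq _ _ r.*2) ?(wq _ _ r.*2.+1); [|lia|lia]; rewrite /write eqxx; split=> //.
    by rewrite h1 h2 -hpS hp_le; lia.
  by apply: represents_dec => //; lia.
(* The tests of a zero jump do not look at the temporary quantity, so 0 is written at no cost. *)
move=> /(IH _ _ (write q nr.*2 0) (represents_write_temp 0 hq)) [l [hl sl]].
exists ((0, true) :: l); split; last by rewrite big_cons /= add0r sum_write_temp in sl *.
split=> //=; first by rewrite /men E.
  apply/(@passes_eq _ _ _ r.*2 r.*2.+1); first by rewrite /mts E.
  by rewrite /mwr /= !wq; [rewrite h1 h2 fr|lia|lia].
by rewrite /mnx /= E.
Qed.

End Compile.

(** * Integrals of functions that are only almost surely measurable *)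

Section Sandwich.
Local Open Scope ereal_scope.
Context d (T : measurableType d) (R : realType).

(* No measurability is needed, because the integral of a nonnegative function
   is a supremum over the simple functions below it. *)
Lemma le_integral_nonneg (mu : {measure set T -> \bar R}) (D : set T) (f g : T -> \bar R) :
  (forall x, D x -> 0 <= f x) -> (forall x, D x -> f x <= g x) ->
  \int[mu]_(x in D) f x <= \int[mu]_(x in D) g x.
Proof.
move=> f0 fg; rewrite !ge0_integralE //; last first.
  by move=> x Dx; apply: le_trans (fg x Dx); exact: f0.
apply: ereal_sup_le => _ [h /= hf <-]; exists h => //= x.
apply: le_trans (hf x) _.
by rewrite /patch; case: ifPn => // /[!inE]; exact: fg.
Qed.

Lemma measurable_fun_else_cst (D E : set T) (g : T -> \bar R) (a : \bar R) :
  measurable D -> measurable E -> measurable_fun D g ->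
  measurable_fun D (fun x => if x \in E then g x else a).
Proof.
move=> mD mE mg; apply: (measurable_fun_if mD).
- apply: (@measurable_funTS _ _ _ _ D); apply: (measurable_fun_bool true).
  by rewrite setTI [X in measurable X](_ : _ = E) //; apply/seteqP; split=> x /=;
    [move/set_mem|move/mem_set].
- by apply: measurable_funS mg => //; exact: subIsetl.
- exact: measurable_cst.
Qed.

(** No measurability of [f] is assumed. It lies between the functions that agree with [g] on [E] and
    are 0, respectively [+oo], elsewhere; both are measurable with the integral of [g]. This is
    applied to [step_law] as a function of the path. *)
Lemma integral_eq_full_measure (P : probability T R) (D E : set T) (f g : T -> \bar R) :
  measurable D -> measurable E -> P E = 1 -> measurable_fun D g ->
  (forall x, 0 <= f x) -> (forall x, 0 <= g x) ->
  (forall x, D x -> E x -> f x = g x) ->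
  \int[P]_(x in D) f x = \int[P]_(x in D) g x.
Proof.
move=> mD mE PE mg f0 g0 fg.
have nE : P.-negligible (~` E).
  apply/negligibleP; first exact: measurableC.
  by apply: etrans (probability_setC P mE) _; rewrite PE subee.
have gE a : 0 <= a -> \int[P]_(x in D) (if x \in E then g x else a) = \int[P]_(x in D) g x.
  move=> a0; apply: ge0_ae_eq_integral => //.
  - exact: measurable_fun_else_cst.
  - by move=> x _; case: ifP.
  - apply: negligibleS nE => x /= h Ex; apply: h => _ /=.
    by rewrite mem_set.
apply/eqP; rewrite eq_le; apply/andP; split.
  rewrite -(gE +oo) ?leey //; apply: le_integral_nonneg => // x Dx.
  by case: ifPn => [/[!inE] Ex|_]; rewrite ?leey // fg.
rewrite -(gE 0) //; apply: le_integral_nonneg => x Dx; first by case: ifP.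
by case: ifPn => [/[!inE] Ex|_] //; rewrite fg.
Qed.

Lemma probability_setI_full (P : probability T R) (A E : set T) :
  measurable A -> measurable E -> P E = 1 -> P (A `&` E) = P A.
Proof.
move=> mA mE PE; apply/esym.
rewrite (@measureDI _ _ _ P A E mA mE) [X in X + _](_ : _ = 0) ?add0e //.
apply: (@subset_measure0 _ _ _ P _ (~` E)).
- exact: measurableD.
- exact: measurableC.
- exact: subDsetr.
- by apply: etrans (probability_setC P mE) _; rewrite PE subee.
Qed.

End Sandwich.

(** * Measurability of events on runs *)

Section Runs.
Context (R : realType) (n k : nat).
Local Notation move := (move R n k).
Local Notation paths := (paths R n k).

Lemma measurable_move_edge (S : set (edge n k)) : measurable [set x : move | S x.2].
Proof.
by rewrite -[X in measurable X]setTI; exact: (@measurable_snd _ _ R (edge n k)).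
Qed.

Lemma measurable_move1 (x0 : move) : measurable [set x : move | x = x0].
Proof.
rewrite [X in measurable X](_ : _ = (fst @^-1` [set x0.1]) `&` [set x : move | x.2 = x0.2]).
  apply: measurableI; last exact: (@measurable_move_edge [set x0.2]).
  rewrite -[X in measurable X]setTI.
  exact: (@measurable_fst _ _ R (edge n k) measurableT [set x0.1] (measurable_set1 _)).
apply/seteqP; split=> [x /= -> //|x /= [h1 h2]].
by case: x x0 h1 h2 => [? ?] [? ?] /= -> ->.
Qed.

Lemma measurable_coord i : measurable_fun setT (fun w : paths => w i : move).
Proof.
move=> _ B mB; rewrite setTI; apply: sub_sigma_algebra.
by exists i; exists B.
Qed.

Lemma measurable_coord_set i (B : set move) : measurable B ->
  measurable [set w : paths | B (w i)].
Proof. by move=> mB; rewrite -[X in measurable X]setTI; exact: measurable_coord. Qed.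

Lemma measurable_to_paths d (T : measurableType d) (f : T -> paths) :
  (forall i, measurable_fun setT (fun t => f t i : move)) -> measurable_fun setT f.
Proof.
move=> mf; apply: (@measurability _ _ _ _ setT f (@cylinders R n k)) => //.
move=> _ [_ [i [B mB ->]] <-].
exact: mf i measurableT _ mB.
Qed.

Lemma measurable_prefix m : measurable_fun setT (@run_prefix R n k m).
Proof.
apply/measurable_fun_tnthP => i.
rewrite (_ : _ \o _ = fun w : paths => w i); first exact: measurable_coord.
by apply/funext => w /=; rewrite tnth_mktuple.
Qed.

Lemma measurable_prefix_set m (A : set (m.-tuple move)) : measurable A ->
  measurable [set w : paths | A (run_prefix m w)].
Proof. by move=> mA; rewrite -[X in measurable X]setTI; exact: measurable_prefix. Qed.

Lemma measurable_tuple1 m (h0 : seq move) : measurable [set h : m.-tuple move | tval h = h0].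
Proof.
have [sz|/eqP sz] := eqVneq (size h0) m; last first.
  rewrite [X in measurable X](_ : _ = set0) //.
  by apply/seteqP; split=> // h /= e; apply: sz; rewrite -e size_tuple.
rewrite [X in measurable X](_ : _ = \bigcap_(i in [set: 'I_m])
    ((fun h : m.-tuple move => tnth h i) @^-1` [set x : move | x = nth point h0 i])).
  apply: fin_bigcap_measurable => // i _; rewrite -[X in measurable X]setTI.
  by apply: (measurable_tnth i measurableT); exact: measurable_move1.
apply/seteqP; split=> [h /= <- i _ /=|h /= hh]; first exact: tnth_nth.
apply: (@eq_from_nth _ point); rewrite size_tuple // => i im.
by have := hh (Ordinal im) I; rewrite /= (tnth_nth point).
Qed.

Variables (G : arena n k) (s0 : state R n k).

Lemma run_prefixS m (w : paths) : run_prefix m.+1 w = rcons (run_prefix m w) (w m) :> seq move.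
Proof.
apply: (@eq_from_nth _ point); rewrite size_tuple ?size_rcons ?size_tuple // => i im.
rewrite -(tnth_nth _ _ (Ordinal im)) tnth_mktuple nth_rcons size_tuple.
rewrite [Ordinal im : nat]/=; case: (ltngtP i m) => [lt|gt|-> //]; last by move: im gt => /=;
  lia.
by rewrite -(tnth_nth _ _ (Ordinal lt)) tnth_mktuple.
Qed.

Lemma last_state_rcons (s : state R n k) h (m : move) :
  last_state s (rcons h m) = post (last_state s h) m.
Proof. by rewrite /last_state foldl_rcons. Qed.

Lemma is_run_rcons (A : timed_automaton n k) (s : state R n k) h (m : move) :
  is_run A s (rcons h m) <-> is_run A s h /\ can_take A (last_state s h) m.
Proof.
elim: h s => [|m' h IH] s /=; first by split=> [[]|[]].
by split=> [[h1 /IH[h2 h3]]|[[h1 h2] h3]]; [split|split=> //; apply/IH].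
Qed.

Lemma is_run_is_state (A : timed_automaton n k) (s : state R n k) h :
  is_state A s -> is_run A s h -> is_state A (last_state s h).
Proof.
elim: h s => [//|m h IH] s hs /= [[[_ _ m0] [_ _ hinv]] hr].
apply: IH hr; split=> // i; rewrite !tnth_mktuple.
by case: ifP => // _; apply: addr_ge0 => //; case: hs.
Qed.

Lemma cmp_holds_convex c (x t t' : R) (b : nat) : 0 <= t' <= t ->
  cmp_holds c x b%:R -> cmp_holds c (x + t) b%:R -> cmp_holds c (x + t') b%:R.
Proof.
by move=> /andP[? ?]; case: c => /=; rewrite -?(rwP eqP); lra.
Qed.

(** Each atomic constraint holds on an interval of clock values. An invariant along a whole delay
    thus reduces to its two endpoints, which turns an uncountable conjunction into a measurable
    condition. *)
Lemma sat_convex (v : valuation R k) (c : constraint k) (t : R) : 0 <= t ->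
  (forall t', 0 <= t' <= t -> sat (delay v t') c) <-> sat v c /\ sat (delay v t) c.
Proof.
move=> t0; split=> [h|[h0 h1] t' t't].
  split; last by apply: h; rewrite t0 lexx.
  have := h 0; rewrite lexx => /(_ t0); rewrite /sat; apply: sub_all => a.
  by rewrite tnth_mktuple addr0.
elim: c h0 h1 => //= a c IH /andP[h0 h0'] /andP[h1 h1']; apply/andP; split; last exact: IH.
by move: h0 h1; rewrite !tnth_mktuple; exact: cmp_holds_convex.
Qed.

Definition state_at (i : nat) (w : paths) := last_state s0 (run_prefix i w).

Lemma run_prefix0 (w : paths) : run_prefix 0 w = [::] :> seq move.
Proof. by apply/nilP; rewrite /nilp size_tuple. Qed.

Lemma state_at0 w : state_at 0 w = s0.
Proof. by rewrite /state_at run_prefix0. Qed.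

Lemma state_atS i w : state_at i.+1 w = post (state_at i w) (w i).
Proof. by rewrite /state_at run_prefixS last_state_rcons. Qed.

Lemma measurable_state_loc i (S : set 'I_n.+1) : measurable [set w | S (state_at i w).1].
Proof.
case: i => [|i].
  have [h|h] := pselect (S s0.1).
    rewrite [X in measurable X](_ : _ = setT) //.
    by apply/seteqP; split=> // w _ /=; rewrite state_at0.
  rewrite [X in measurable X](_ : _ = set0) //.
  by apply/seteqP; split=> // w /=; rewrite state_at0.
rewrite [X in measurable X](_ : _ = [set w : paths | S (tgt (w i).2)]).
  by apply: (@measurable_coord_set i [set x | S (tgt x.2)]);
    exact: (@measurable_move_edge [set e | S (tgt e)]).
by apply/seteqP; split=> w /=; rewrite state_atS.
Qed.

Lemma measurable_delay_coord i : measurable_fun setT (fun w : paths => (w i).1).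
Proof. exact: (measurableT_comp measurable_fst (measurable_coord i)). Qed.

Lemma measurable_state_clock i x : measurable_fun setT (fun w => tnth (state_at i w).2 x).
Proof.
elim: i => [|i IH].
  rewrite (_ : (fun w => _) = cst (tnth s0.2 x)); first exact: measurable_cst.
  by apply/funext => w; rewrite state_at0.
rewrite (_ : (fun w => _) = (fun w : paths => if x \in resets (w i).2 then 0
    else tnth (state_at i w).2 x + (w i).1)); last first.
  by apply/funext => w; rewrite state_atS !tnth_mktuple.
apply: measurable_fun_ifT; last 2 first.
- exact: measurable_cst.
- by apply: measurable_funD => //; exact: measurable_delay_coord.
apply: (measurable_fun_bool true); rewrite setTI.
apply: (@measurable_coord_set i [set y | (x \in resets y.2) = true]).
exact: (@measurable_move_edge [set e | (x \in resets e) = true]).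
Qed.

Lemma measurable_cmp_holds d (T : measurableType d) c (f : T -> R) (b : R) :
  measurable_fun setT f -> measurable [set t | cmp_holds c (f t) b].
Proof.
move=> mf; have mb := @measurable_cst _ _ T R setT b.
rewrite [X in measurable X](_ : _ = (fun t => cmp_holds c (f t) b) @^-1` [set true]);
  last first.
  by apply/seteqP; split=> t /=.
rewrite -[X in measurable X]setTI.
have {}mf : measurable_fun setT (fun t => cmp_holds c (f t) b); last exact: mf.
case: c => /=.
- exact: measurable_fun_ltr.
- exact: measurable_fun_ler.
- exact: measurable_fun_eqr.
- exact: measurable_fun_ler.
- exact: measurable_fun_ltr.
Qed.

Lemma measurable_sat d (T : measurableType d) (v : T -> valuation R k) (c : constraint k) :
  (forall x, measurable_fun setT (fun t => tnth (v t) x)) ->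
  measurable [set t | sat (v t) c].
Proof.
move=> mv; elim: c => [|a c IH].
  by rewrite [X in measurable X](_ : _ = setT) //; apply/seteqP; split.
rewrite [X in measurable X](_ : _ =
    [set t | cmp_holds a.1.2 (tnth (v t) a.1.1) a.2%:R] `&` [set t | sat (v t) c]).
  by apply: measurableI => //; exact: measurable_cmp_holds.
apply/seteqP; split=> t; rewrite /sat /=; first by case/andP.
by case=> h1 h2; apply/andP.
Qed.

Lemma measurable_can_take (A : timed_automaton n k) i :
  measurable [set w : paths | can_take A (state_at i w) (w i)].
Proof.
pose F (e : edge n k) := [set w : paths | (w i).2 = e] `&`
  ([set w | src e = (state_at i w).1] `&` ([set w : paths | cmp_holds CGe (w i).1 0] `&`
  ([set w | sat (delay (state_at i w).2 (w i).1) (guard e)] `&`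
  ([set w | sat (state_at i w).2 (Defs.invariant A (src e))] `&`
  ([set w | sat (delay (state_at i w).2 (w i).1) (Defs.invariant A (src e))] `&`
   [set w | sat (reset (delay (state_at i w).2 (w i).1) (resets e))
      (Defs.invariant A (tgt e))]))))).
rewrite [X in measurable X](_ : _ = \bigcup_(e in [set` edges A]) F e).
  apply: fin_bigcup_measurable => [|e _]; first exact: finite_seq.
  have mc := measurable_state_clock i; have md := measurable_delay_coord i.
  apply: measurableI.
    exact: (@measurable_coord_set i [set y | y.2 = e] (@measurable_move_edge [set e])).
  apply: measurableI; first exact: (@measurable_state_loc i [set l | src e = l]).
  apply: measurableI; first exact: measurable_cmp_holds.
  have mdel x : measurable_fun setT (fun w => tnth (delay (state_at i w).2 (w i).1) x).
    rewrite (_ : (fun w => _) = fun w => tnth (state_at i w).2 x + (w i).1).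
      exact: measurable_funD.
    by apply/funext => w; rewrite tnth_mktuple.
  do 3 (apply: measurableI; first exact: measurable_sat).
  apply: measurable_sat => x; have [xe|xe] := boolP (x \in resets e).
    rewrite (_ : (fun w => _) = cst 0); first exact: measurable_cst.
    by apply/funext => w; rewrite tnth_mktuple xe.
  rewrite (_ : (fun w => _) = fun w => tnth (delay (state_at i w).2 (w i).1) x) //.
  by apply/funext => w; rewrite tnth_mktuple (negbTE xe).
apply/seteqP; split=> [w [[h1 h2 h3] [h4 h5 h6]]|w [e /= eA [h1 [h2 [h3 [h4 [h5 [h6 h7]]]]]]]].
  exists (w i).2 => //; split=> //; split=> //; split=> //; split=> //.
  by move: h5; rewrite -h2 => /(sat_convex _ _ h3)[h5 h5'].
rewrite /can_take h1 -h2; split; split=> //.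
  by apply/(sat_convex _ _ h3).
by rewrite /post h1.
Qed.

Lemma infinite_runsE : infinite_runs G s0 =
  \bigcap_i [set w : paths | can_take G (state_at i w) (w i)].
Proof.
apply/seteqP; split=> [w h i _|w h m].
  by have := h i.+1; rewrite /= run_prefixS => /is_run_rcons[].
elim: m => [|m IH]; last by rewrite run_prefixS; apply/is_run_rcons; split=> //; exact: h.
by rewrite (_ : tval _ = [::]) //; apply/nilP; rewrite /nilp size_tuple.
Qed.

Lemma measurable_reach (T : {set 'I_n.+1}) (D : R) : measurable (reach G s0 T D).
Proof.
apply: measurableI.
  by rewrite infinite_runsE; apply: bigcap_measurable => // i _; exact: measurable_can_take.
rewrite [X in measurable X](_ : _ = \bigcup_m ([set w | (state_at m w).1 \in T] `&`
    [set w : paths | cmp_holds CLe (\sum_(i < m) (w i).1) D])).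
  apply: bigcup_measurable => m _; apply: measurableI.
    exact: (@measurable_state_loc m [set l | l \in T]).
  apply: measurable_cmp_holds; apply: measurable_sum => i.
  exact: measurable_delay_coord.
by apply/seteqP; split=> [w [m [h1 h2]]|w [m _ [h1 h2]]]; exists m.
Qed.

End Runs.

(** * Plays with at most one random draw *)

Section Plays.
Context (R : realType) (n k : nat).
Local Notation move := (move R n k).
Local Notation paths := (paths R n k).
Variables (G : arena n k) (mu : delay_measures R n k) (s0 : state R n k).
Local Notation last_state := (last_state s0).
Local Notation loc h := (last_state h).1.

(** Among the histories of a given length at most one is treated specially, and otherwise only the
    location counts; this makes the strategy measurable. *)
Definition follow (pi : seq move) (dflt : 'I_n.+1 -> move) : strategy R n k :=
  fun h => if (size h < size pi)%N && (h == take (size h) pi)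
           then nth point pi (size h) else dflt (loc h).

Lemma measurable_loc_tuple m (S : set 'I_n.+1) : measurable [set h : m.-tuple move | S (loc h)].
Proof.
case: m => [|m].
  have h0 (h : 0.-tuple move) : loc h = s0.1 by rewrite (tuple0 h).
  have [h|h] := pselect (S s0.1).
    rewrite [X in measurable X](_ : _ = setT) //.
    by apply/seteqP; split=> // w _ /=; rewrite h0.
  rewrite [X in measurable X](_ : _ = set0) //.
  by apply/seteqP; split=> // w /=; rewrite h0.
rewrite [X in measurable X](_ : _ =
    (fun h : m.+1.-tuple move => tnth h ord_max) @^-1` [set x | S (tgt x.2)]).
  rewrite -[X in measurable X]setTI.
  by apply: (measurable_tnth ord_max measurableT);
    exact: (@measurable_move_edge _ _ _ [set e | S (tgt e)]).
have e (h : m.+1.-tuple move) : loc h = tgt (tnth h ord_max).2.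
  rewrite (tnth_nth point); case: h => h /= /eqP sh.
  by case/lastP: h sh => // h x; rewrite size_rcons => -[<-];
    rewrite last_state_rcons nth_rcons ltnn eqxx.
by apply/seteqP; split=> h; rewrite /= e.
Qed.

Lemma measurable_follow m (D : set (m.-tuple move)) pi dflt :
  measurable_fun D (fun h : m.-tuple move => follow pi dflt h).
Proof.
apply: measurable_funTS => _ B mB; rewrite setTI.
pose eqpi := [set h : m.-tuple move | tval h = take m pi].
have meq : measurable eqpi by exact: measurable_tuple1.
have mloc : measurable [set h : m.-tuple move | B (dflt (loc h))].
  exact: (@measurable_loc_tuple m [set l | B (dflt l)]).
have [sz|sz] := boolP (m < size pi)%N; last first.
  rewrite [X in measurable X](_ : _ = [set h : m.-tuple move | B (dflt (loc h))]) //.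
  by apply/seteqP; split=> h /=; rewrite /follow size_tuple (negbTE sz).
have [hB|hB] := pselect (B (nth point pi m)).
  rewrite [X in measurable X](_ : _ = eqpi `|` [set h : m.-tuple move | B (dflt (loc h))]).
    exact: measurableU.
  apply/seteqP; split=> h; rewrite /follow /eqpi /= size_tuple sz /=.
    by case: eqP => [->|_]; [left|right].
  by case: eqP => [_|ne] // [].
rewrite [X in measurable X](_ : _ = ~` eqpi `&` [set h : m.-tuple move | B (dflt (loc h))]).
  by apply: measurableI => //; exact: measurableC.
apply/seteqP; split=> h; rewrite /follow /eqpi /= size_tuple sz /=.
  by case: eqP.
by case: eqP => [e|_] // [].
Qed.

Lemma is_run_take (A : timed_automaton n k) (s : state R n k) pi i :
  is_run A s pi -> is_run A s (take i pi).
Proof. by elim: pi s i => [|m pi IH] s [|i] //= [h1 /IH h2]. Qed.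

Lemma is_run_nth pi i : is_run G s0 pi -> (i < size pi)%N ->
  can_take G (last_state (take i pi)) (nth point pi i).
Proof.
move=> /(@is_run_take _ _ _ i.+1) + ip; rewrite (take_nth point) //.
by move=> /is_run_rcons[].
Qed.

Lemma follow_strategy p pi dflt : is_run G s0 pi ->
  (forall h, player_runs G s0 p h -> can_take G (last_state h) (dflt (loc h))) ->
  is_strategy G s0 p (follow pi dflt).
Proof.
move=> hpi hd; split=> [h hh|m]; last exact: measurable_follow.
rewrite /follow; case: ifP => [/andP[sz /eqP e]|_]; last exact: hd.
by rewrite {1}e; exact: is_run_nth.
Qed.

Definition det_move (sD sB : strategy R n k) (h : seq move) : option move :=
  match owner G (loc h) with
  | Diamond => Some (sD h) | Box => Some (sB h) | Stochastic => None end.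

Definition det_play sD sB (pi : seq move) : Prop :=
  forall i, (i < size pi)%N -> det_move sD sB (take i pi) = Some (nth point pi i).

Lemma det_play_rcons sD sB pi x : det_play sD sB (rcons pi x) <->
  det_play sD sB pi /\ det_move sD sB pi = Some x.
Proof.
split=> [h|[h hx] i]; last first.
  rewrite size_rcons ltnS leq_eqVlt => /predU1P[->|ip].
    by rewrite nth_rcons ltnn eqxx -cats1 take_size_cat.
  by rewrite nth_rcons ip -cats1 takel_cat ?(ltnW ip) //; exact: h.
split=> [i ip|]; last first.
  by have := h (size pi);
    rewrite size_rcons ltnSn nth_rcons ltnn eqxx -cats1 take_size_cat // => ->.
have := h i; rewrite size_rcons ltnS nth_rcons ip -cats1 takel_cat ?(ltnW ip) // => ->;
  rewrite ?ltnW //.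
Qed.

Lemma step_law_det sD sB h x B : det_move sD sB h = Some x ->
  step_law G mu s0 sD sB h B = (\d_x B)%E.
Proof. by rewrite /det_move /step_law; case: owner => // -[->]. Qed.

Lemma step_law_ge0 sD sB h B : (0 <= step_law G mu s0 sD sB h B)%E.
Proof.
rewrite /step_law; case: owner => //.
apply: integral_ge0 => t _; rewrite lee_fin; apply: sumr_ge0 => e _.
by apply: divr_ge0 => //; apply: sumr_ge0.
Qed.

(** * Bounds valid for every law induced by two strategies *)

Section Upper.
Variables (sD sB : strategy R n k) (P : probability paths R).
Hypothesis hP : induces G mu s0 sD sB P.

Lemma measurable_prefix_eq m (pi : seq move) :
  measurable [set w : paths | run_prefix m w = pi :> seq move].
Proof.
exact: (measurable_prefix_set (A := [set h : m.-tuple move | tval h = pi]) (@measurable_tuple1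
  _ _ _ m pi)).
Qed.

Lemma prob_next pi B : measurable B ->
  P [set w | run_prefix (size pi) w = pi :> seq move] = 1%E ->
  P [set w : paths | run_prefix (size pi) w = pi :> seq move /\ B (w (size pi))] =
  step_law G mu s0 sD sB pi B.
Proof.
move=> mB Ppi; have mpi := measurable_prefix_eq (size pi) pi.
have := @hP _ [set h : (size pi).-tuple move | tval h = pi] B (@measurable_tuple1 _ _ _ _ pi)
  mB.
move=> /= ->; rewrite (eq_integral (cst (step_law G mu s0 sD sB pi B))).
  apply: etrans (integral_cst P mpi _) _.
  exact: etrans (congr1 (mule _) Ppi) (mule1 _).
by move=> w; rewrite inE /= => ->.
Qed.

(** Where a player moves, [step_law] is a Dirac mass, so each further label keeps full
    probability. *)
Lemma prob_det_play pi : det_play sD sB pi ->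
  P [set w : paths | run_prefix (size pi) w = pi :> seq move] = 1%E.
Proof.
elim/last_ind: pi => [|pi x IH].
  move=> _; rewrite (_ : [set w | _] = setT) ?probability_setT //.
  by apply/seteqP; split=> // w _ /=; rewrite run_prefix0.
move=> /det_play_rcons[/IH {}IH hx].
have := prob_next (@measurable_move1 R n k x) IH.
rewrite (step_law_det _ hx) diracE mem_set //= => <-; rewrite size_rcons.
congr (P _); apply/seteqP; split=> w; rewrite /mkset run_prefixS.
  by move=> /rcons_inj[e1 e2]; split.
by move=> [e1 e2]; exact: congr2 e1 e2.
Qed.

(** A path that reaches [T] leaves the histories [hist] at some finite length, and these are
    countably many null events. *)
Lemma prob_reach_never (T : {set 'I_n.+1}) (D : R) (hist : nat -> seq move) :
  (forall m, size (hist m) = m) -> (forall m, det_play sD sB (hist m)) ->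
  (forall m, loc (hist m) \notin T) -> P (reach G s0 T D) = 0%E.
Proof.
move=> sz hd hT.
have mh m := measurable_prefix_eq m (hist m).
have null m : P (~` [set w : paths | run_prefix m w = hist m :> seq move]) = 0%E.
  have := prob_det_play (hd m); rewrite sz => h.
  by apply: etrans (probability_setC P (mh m)) _; rewrite h subee.
apply: measure_negligible; first exact: measurable_reach.
apply: (@negligibleS _ _ _ P (\bigcup_m ~` [set w : paths | run_prefix m w = hist m :> seq
  move])).
  move=> w [_ [m [wT _]]]; exists m => // e.
  by move/negP: (hT m); apply; rewrite -e.
apply: negligible_bigcup => m; apply/negligibleP; last exact: null.
by apply: measurableC; exact: mh.
Qed.

Lemma prob_reach_draw (T : {set 'I_n.+1}) (D : R) pi (B : set move) :
  det_play sD sB pi -> measurable B ->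
  (forall w, reach G s0 T D w -> run_prefix (size pi) w = pi :> seq move -> B (w (size pi))) ->
  (P (reach G s0 T D) <= step_law G mu s0 sD sB pi B)%E.
Proof.
move=> hd mB hB; have Ppi := prob_det_play hd.
have mpi := measurable_prefix_eq (size pi) pi.
have mr := measurable_reach G s0 T D.
rewrite -(prob_next mB Ppi) -(probability_setI_full mr mpi Ppi).
apply: le_measure; rewrite ?inE.
- exact: measurableI.
- by apply: measurableI => //; exact: measurable_coord_set.
- by move=> w [wr wpi]; split=> //; exact: hB.
Qed.

End Upper.

(** * The label drawn at a stochastic state with one enabled edge per delay *)

Section Draw.
Variables (s : state R n k) (sel : R -> edge n k).
Hypotheses (uG : uniq (edges G)).
Hypotheses (wG : forall e, e \in edges G -> src e = s.1 -> (0 < weight G e)%N).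
Hypotheses (os : owner G s.1 = Stochastic).
Hypotheses (mV : measurable (delays G s)) (muV : mu s (delays G s) = 1%E).
Hypothesis (msel : forall S : set (edge n k), measurable [set t | S (sel t)]).
Hypothesis (selP : forall t, delays G s t -> forall e, can_take G s (t, e) <-> e = sel t).

Lemma measurable_draw : measurable_fun setT (fun t => (t, sel t) : move).
Proof.
apply: measurable_fun_pair => // _ S _; rewrite setTI; exact: msel.
Qed.

(** The only enabled edge has normalised weight 1, so the integrand is an indicator on the possible
    delays. *)
Lemma step_law_draw sD sB h (B : set move) : last_state h = s -> measurable B ->
  step_law G mu s0 sD sB h B = mu s [set t | B (t, sel t)].
Proof.
move=> hs mB; rewrite /step_law hs os.
have mBs : measurable [set t | B (t, sel t)].
  by rewrite -[X in measurable X]setTI; exact: measurable_draw.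
rewrite (eq_integral (fun t => (\1_[set t | B (t, sel t)] t)%:E)).
  rewrite integral_indic //; exact: probability_setI_full.
move=> t; rewrite inE => tV; congr EFin; rewrite indicE.
have [selG sels] : sel t \in edges G /\ src (sel t) = s.1.
  by have /selP/(_ (sel t))[_ /(_ erefl)[[]]] := tV.
have -> : total_weight G s t = (weight G (sel t))%:R.
  rewrite /total_weight (big_rem _ selG) /= ifT; last by apply/asboolP/selP.
  rewrite big1_seq ?addr0 // => e /andP[/asboolP/(selP tV) ->].
  by rewrite mem_rem_uniq // inE eqxx.
have w0 : (weight G (sel t))%:R != 0 :> R by rewrite pnatr_eq0 -lt0n wG.
rewrite (big_rem _ selG) /= big1_seq ?addr0; last first.
  move=> e /andP[/asboolP[/(selP tV) -> _]].
  by rewrite mem_rem_uniq // inE eqxx.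
have [Bt|Bt] := pselect (B (t, sel t)).
  rewrite ifT ?mem_set //; first by rewrite divff.
  by apply/asboolP; split=> //; apply/selP.
rewrite ifF ?memNset //.
by apply/asboolP => -[].
Qed.

End Draw.

(** * Construction of an induced law *)

Section Lower.
Variables (sD sB : strategy R n k).

(** At each time either the next label is a function of the prefix, and [step_law] is the Dirac mass
    at that label, or the prefix is constant on [E], and [step_law] can be taken out of the
    integral. This suffices for plays with a single draw and avoids any general construction of
    processes. *)
Lemma induces_intro (P : probability paths R) (E : set paths) :
  measurable E -> P E = 1%E ->
  (forall m,
    (forall w, E w -> det_move sD sB (run_prefix m w) = Some (w m)) \/
    (exists h : seq move, (forall w, E w -> run_prefix m w = h :> seq move) /\
      forall B, measurable B -> step_law G mu s0 sD sB h B = P [set w : paths | B (w m)])) ->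
  induces G mu s0 sD sB P.
Proof.
move=> mE PE hE m A B mA mB.
have mp := measurable_prefix_set mA; have mc := measurable_coord_set m mB.
case: (hE m) => [hdet|[h [hh hB]]].
  rewrite (@integral_eq_full_measure _ _ _ P _ E _ (fun w : paths => (\1_[set w : paths | B (w
    m)] w)%:E)) //.
  - rewrite integral_indic // setIC; congr (P _); exact/seteqP.
  - by apply/measurable_EFinP; exact: measurable_indic.
  - by move=> w; exact: step_law_ge0.
  - move=> w wA wE; rewrite (step_law_det _ (hdet w wE)) diracE indicE.
    by congr (_%:R%:E); congr nat_of_bool; apply/idP/idP; rewrite !inE.
rewrite (@integral_eq_full_measure _ _ _ P _ E _ (cst (step_law G mu s0 sD sB h B))) //;
  last 3 first.
- by move=> w; exact: step_law_ge0.
- by move=> w; exact: step_law_ge0.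
- by move=> w wA wE; rewrite /= (hh w wE).
apply: esym; apply: etrans (integral_cst P mp _) _.
(* As the prefix is constant on [E], the event [A] has probability 1 or 0. *)
have [Ah|nAh] := pselect (exists2 h' : m.-tuple move, A h' & tval h' = h).
  have sub w : E w -> A (run_prefix m w).
    move=> wE; case: Ah => h' Ah' eh'; rewrite (_ : run_prefix m w = h') //.
    by apply: val_inj; rewrite /= eh' hh.
  have PA1 : P [set w | A (run_prefix m w)] = 1%E.
    rewrite -(probability_setI_full mp mE PE) (_ : _ `&` _ = E) //.
    by apply/seteqP; split=> [w []|w wE] //; split=> //; exact: sub.
  apply: etrans (congr1 (mule _) PA1) _; rewrite mule1 hB //.
  have mAB := measurableI _ _ mp mc.
  apply: etrans (esym (probability_setI_full mc mE PE)) _.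
  apply: etrans (probability_setI_full mAB mE PE).
  congr (P _); apply/seteqP; split=> w /= [].
    by move=> wB wE; split=> //; split=> //; exact: sub.
  by move=> [_ wB] wE; split.
have z (X : set paths) : measurable X -> X `<=` [set w | A (run_prefix m w)] -> P X = 0%E.
  move=> mX XA; rewrite -(probability_setI_full mX mE PE) (_ : _ `&` _ = set0) ?measure0 //.
  apply/seteqP; split=> // w [/XA wA wE]; apply: nAh; exists (run_prefix m w) => //; exact: hh.
apply: etrans (congr1 (mule _) (z _ mp (fun _ => id))) _; rewrite mule0.
by apply/esym/(z _ (measurableI _ _ mp mc)) => w [].
Qed.

End Lower.
Lemma take_run_prefix m N (w : paths) : (m <= N)%N ->
  take m (run_prefix N w) = run_prefix m w :> seq move.
Proof.
elim: N => [|N IH]; first by rewrite leqn0 => /eqP ->; rewrite take0 run_prefix0.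
rewrite leq_eqVlt => /predU1P[->|]; first by rewrite take_oversize // size_tuple.
by rewrite ltnS => mN; rewrite run_prefixS -cats1 takel_cat ?size_tuple // IH.
Qed.

Definition path_of (h : seq move) (x : move) : paths := fun i => nth x h i.

Lemma prefix_path_of h x m :
  run_prefix m (path_of h x) = take m h ++ nseq (m - size h) x :> seq move.
Proof.
apply: (@eq_from_nth _ point).
  rewrite size_tuple size_cat size_nseq size_take; case: (ltnP m (size h)) => [mh|hm].
    by rewrite (eqP (ltnW mh : (m - size h == 0)%N)) addn0.
  by rewrite subnKC.
move=> i; rewrite size_tuple => im.
rewrite -(tnth_nth _ _ (Ordinal im)) tnth_mktuple /path_of [Ordinal im : nat]/=.
rewrite nth_cat size_take nth_nseq; case: (ltnP m (size h)) => mh.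
  by rewrite im nth_take //; apply: set_nth_default; exact: ltn_trans mh.
case: (ltnP i (size h)) => ih; first by rewrite nth_take //; apply: set_nth_default.
by rewrite ifT ?nth_default // ltn_subRL subnKC.
Qed.

Lemma is_run_cat (A : timed_automaton n k) (s : state R n k) h h' :
  is_run A s (h ++ h') <-> is_run A s h /\ is_run A (Defs.last_state s h) h'.
Proof.
elim: h s => [|m h IH] s /=; first by split=> [|[]].
by split=> [[h1 /IH[]]|[[h1 h2] h3]]; split=> //; apply/IH.
Qed.

Section DrawLaw.
Variables (s : state R n k) (sel : R -> edge n k).
Hypotheses (uG : uniq (edges G)).
Hypotheses (wG : forall e, e \in edges G -> src e = s.1 -> (0 < weight G e)%N).
Hypotheses (os : owner G s.1 = Stochastic).
Hypotheses (mV : measurable (delays G s)) (muV : mu s (delays G s) = 1%E).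
Hypothesis (msel : forall S : set (edge n k), measurable [set t | S (sel t)]).
Hypothesis (selP : forall t, delays G s t -> forall e, can_take G s (t, e) <-> e = sel t).
Variables (sD sB : strategy R n k) (pi : seq move).
Variables (sink : pred 'I_n.+1) (loop : 'I_n.+1 -> move).
Hypotheses (pidet : det_play sD sB pi) (pis : last_state pi = s).
Hypotheses (selsink : forall t, sink (tgt (sel t))).
Hypotheses (sinkD : forall l, sink l -> owner G l = Diamond)
           (loopl : forall l, sink l -> tgt (loop l).2 = l).
Hypothesis (sDloop : forall x j, sink (tgt x.2) ->
  sD (rcons pi x ++ nseq j (loop (tgt x.2))) = loop (tgt x.2)).

Definition draw_path (x : move) : paths := path_of (rcons pi x) (loop (tgt x.2)).

Let N := size pi.

Lemma draw_pathN x : draw_path x N = x.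
Proof. by rewrite /draw_path /path_of nth_rcons ltnn eqxx. Qed.

Lemma last_state_loops j l (s' : state R n k) : sink l -> s'.1 = l ->
  (Defs.last_state s' (nseq j (loop l))).1 = l.
Proof. by move=> sl; elim: j s' => //= j IH s' _; apply: IH; exact: loopl. Qed.

Definition draw_event : set paths :=
  [set w | sink (tgt (w N).2) /\ w = draw_path (w N)].

(** The equation between paths is split into countably many coordinates, and each of these by the
    finitely many sinks, so that the label repeated at the end becomes a constant. *)
Lemma measurable_draw_event : measurable draw_event.
Proof.
pose F i := [set w : paths | sink (tgt (w N).2) /\ w i = draw_path (w N) i].
have ms l : measurable [set w : paths | sink l && (tgt (w N).2 == l)].
  apply: (@measurable_coord_set _ _ _ N [set x | sink l && (tgt x.2 == l)]).
  exact: (@measurable_move_edge _ _ _ [set e | sink l && (tgt e == l)]).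
have mF i : measurable (F i).
  rewrite [X in measurable X](_ : _ = \bigcup_(l in [set: 'I_n.+1])
    ([set w : paths | sink l && (tgt (w N).2 == l)] `&`
     (if (i < N)%N then [set w : paths | w i = nth point pi i]
      else if i == N then setT else [set w : paths | w i = loop l]))).
    apply: fin_bigcup_measurable => // l _; apply: measurableI => //.
    case: ifP => _; first exact: (@measurable_coord_set _ _ _ i [set x | x = _]
      (@measurable_move1 _ _ _ _)).
    case: ifP => _ //; exact: (@measurable_coord_set _ _ _ i [set x | x = _] (@measurable_move1
      _ _ _ _)).
  have e w : draw_path (w N) i = if (i < N)%N then nth point pi i
      else if i == N then w i else loop (tgt (w N).2).
    rewrite /draw_path /path_of nth_rcons -/N; case: ifP => iN; first exact: set_nth_default.
    by case: eqP => // ->.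
  apply/seteqP; split=> [w [sw]|w [l _ [/andP[sl /eqP lE]]]]; last first.
    move: sl; rewrite -lE => sl h; split=> //; move: h; rewrite e.
    by case: (i < N)%N => //; case: (i == N).
  rewrite e => wi; exists (tgt (w N).2) => //; split; first by rewrite /= sw eqxx.
  by move: wi; case: (i < N)%N => //; case: (i == N).
rewrite [X in measurable X](_ : _ = \bigcap_i F i); first exact: bigcap_measurable.
apply/seteqP; split=> [w [sw wE] i _|w h]; first by split=> //; rewrite -wE.
split; first by case: (h 0%N I).
by apply/funext => i; case: (h i I).
Qed.

Lemma measurable_draw_path : measurable_fun setT (fun t => draw_path (t, sel t)).
Proof.
apply: measurable_to_paths => i; rewrite /draw_path /path_of.
case: (ltngtP i N) => iN.
- rewrite (_ : (fun t => _) = cst (nth point pi i)); first exact: measurable_cst.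
  by apply/funext => t; rewrite nth_rcons iN; exact: set_nth_default.
- rewrite (_ : (fun t => _) = fun t => loop (tgt (sel t))); last first.
    by apply/funext => t; rewrite nth_rcons !ifF //; move: iN; clear; lia.
  by move=> _ B mB; rewrite setTI; exact: (@msel [set e | B (loop (tgt e))]).
- rewrite (_ : (fun t => _) = fun t => (t, sel t)); first exact: measurable_draw.
  by apply/funext => t; rewrite nth_rcons iN ltnn eqxx.
Qed.

(** After the draw Diamond loops in a sink, so the whole path is a function of the drawn delay and
    its law is an image of [mu s]. *)
Lemma draw_law : exists2 P : probability paths R, induces G mu s0 sD sB P &
  forall A : set paths, P A = mu s [set t | A (draw_path (t, sel t))].
Proof.
pose phi : {mfun R >-> paths} := mfun_Sub (mem_set measurable_draw_path).
pose P : probability paths R := distribution (mu s) phi.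
have PE A : P A = mu s [set t | A (draw_path (t, sel t))] by [].
exists P => //; apply: (induces_intro measurable_draw_event).
  rewrite PE (_ : [set t | _] = setT) ?probability_setT //.
  apply/seteqP; split=> // t _; rewrite /draw_event /= draw_pathN; split=> //.
  exact: selsink.
move=> m; case: (ltngtP m N) => mN.
- left=> w [sw wE]; rewrite wE /draw_path prefix_path_of size_rcons.
  rewrite (_ : (m - N.+1 = 0)%N) ?cats0 -?cats1; last by lia.
  rewrite takel_cat ?(ltnW mN) // pidet // /path_of nth_cat mN.
  by congr Some; exact: set_nth_default.
- left=> w [sw wE]; rewrite {1}wE /draw_path prefix_path_of take_oversize ?size_rcons //.
  rewrite /det_move; set l := tgt (w N).2; set h := _ ++ _.
  have -> : loc h = l.
    by rewrite /h /Defs.last_state foldl_cat foldl_rcons last_state_loops.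
  rewrite sinkD //; congr Some; rewrite /h sDloop //.
  by rewrite [in RHS]wE /draw_path /path_of nth_default ?size_rcons.
- right; exists pi; split=> [w [sw wE]|B mB].
    by rewrite wE mN /draw_path prefix_path_of -cats1 take_size_cat // size_cat addn1 subnS
      subnn cats0.
  rewrite (@step_law_draw s sel) // PE; congr (mu s _).
  by apply/seteqP; split=> t; rewrite /mkset mN draw_pathN.
Qed.

Hypotheses (legal : is_run G s0 pi).
Hypothesis (loop_legal : forall (s' : state R n k), sink s'.1 -> can_take G s' (loop s'.1)).

Lemma draw_path_reach t (T : {set 'I_n.+1}) (D : R) : delays G s t -> tgt (sel t) \in T ->
  \sum_(x <- pi) x.1 + t <= D -> reach G s0 T D (draw_path (t, sel t)).
Proof.
move=> tV tT hD; set l := tgt (sel t); have sl : sink l by exact: selsink.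
have pit : is_run G s0 (rcons pi (t, sel t)).
  by apply/is_run_rcons; split=> //; rewrite pis; apply/(selP tV).
have loops j (s' : state R n k) : s'.1 = l -> is_run G s' (nseq j (loop l)).
  elim: j s' => //= j IH s' e; split; last by apply: IH; exact: loopl.
  by rewrite -e; apply: loop_legal; rewrite e.
split=> [m|].
  rewrite /= /draw_path prefix_path_of; apply/is_run_cat; split; first exact: is_run_take.
  case: (ltnP m (size (rcons pi (t, sel t)))) => mN;
    first by rewrite (eqP (ltnW mN : (m - _ == 0)%N)).
  by apply: loops; rewrite take_oversize // last_state_rcons.
have e : run_prefix N.+1 (draw_path (t, sel t)) = rcons pi (t, sel t) :> seq move.
  by rewrite /draw_path prefix_path_of size_rcons subnn cats0 take_oversize // size_rcons.
exists N.+1; rewrite e last_state_rcons; split=> //.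
apply: le_trans hD; have -> : \sum_(i < N.+1) (draw_path (t, sel t) i).1 =
    \sum_(x <- run_prefix N.+1 (draw_path (t, sel t))) x.1.
  by rewrite big_tuple; apply: eq_bigr => i _; rewrite tnth_mktuple.
by rewrite e -cats1 big_cat big_seq1.
Qed.

End DrawLaw.
End Plays.

(** * Uniform delays *)

Section Windows.
Context (R : realType).

(* The [j]-th window is [[jK, (j+1)K[]; in it, a clock with initial value [x]
   reaches [(j+1)K] during the last [x] time units. *)
Definition window (K : R) (j : nat) (p : R * bool) : set R :=
  [set t | j%:R * K <= t < j.+1%:R * K /\ (j.+1%:R * K <= p.1 + t) = p.2].

Definition windows (K : R) (j0 : nat) (ws : seq (R * bool)) : set R :=
  [set t | exists2 j, (j < size ws)%N & window K (j0 + j) (nth (0, false) ws j) t].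

Lemma windows_cons K j0 p ws :
  windows K j0 (p :: ws) = window K j0 p `|` windows K j0.+1 ws.
Proof.
apply/seteqP; split=> t.
  by move=> [[|j] /= jw h]; [left; rewrite addn0 in h|right; exists j => //; rewrite addSnnS].
move=> [h|[j jw h]]; first by exists 0%N; rewrite ?addn0.
by exists j.+1 => //=; rewrite -addSnnS.
Qed.

Lemma windowE (K : R) j p : 0 <= p.1 <= K -> window K j p =
  if p.2 then `[j.+1%:R * K - p.1, j.+1%:R * K[%classic
  else `[j%:R * K, j.+1%:R * K - p.1[%classic.
Proof.
case: p => x b /= /andP[x0 xK].
have e : j.+1%:R * K = j%:R * K + K by rewrite -natr1 mulrDl mul1r.
rewrite /window; apply/seteqP; split=> t /=; case: b; rewrite /= in_itv /= e.
- by move=> [/andP[h1 h2] h3]; rewrite h2 andbT; lra.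
- by move=> [/andP[h1 h2] /negbT]; rewrite -ltNge h1 /=; lra.
- by move=> /andP[h1 h2]; split; [apply/andP; split; lra|apply/idP; lra].
- by move=> /andP[h1 h2]; split; [apply/andP; split; lra|apply/negbTE; rewrite -ltNge; lra].
Qed.

Lemma measurable_window (K : R) j p : 0 <= p.1 <= K -> measurable (window K j p).
Proof. by move=> /windowE ->; case: ifP => _; exact: measurable_itv. Qed.

Lemma lebesgue_window (K : R) j p : 0 <= p.1 <= K ->
  lebesgue_measure (window K j p) = (if p.2 then p.1 else K - p.1)%:E.
Proof.
move=> hp; rewrite windowE //; case/andP: hp => p0 pK.
have e : j.+1%:R * K = j%:R * K + K by rewrite -natr1 mulrDl mul1r.
case: ifP => _; rewrite lebesgue_measure_itv /= !lte_fin e.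
  case: ltP => h; first by rewrite -EFinD; congr EFin; ring.
  by congr EFin; lra.
case: ltP => h; first by rewrite -EFinD; congr EFin; ring.
by congr EFin; lra.
Qed.

Lemma measurable_windows (K : R) j0 ws : (forall p, p \in ws -> 0 <= p.1 <= K) ->
  measurable (windows K j0 ws).
Proof.
elim: ws j0 => [|p ws IH] j0 h.
  by rewrite [X in measurable X](_ : _ = set0) //; apply/seteqP; split=> // t [].
rewrite windows_cons; apply: measurableU.
  by apply: measurable_window; apply: h; rewrite inE eqxx.
by apply: IH => q qw; apply: h; rewrite inE qw orbT.
Qed.

Lemma lebesgue_windows (K : R) j0 ws : 0 <= K -> (forall p, p \in ws -> 0 <= p.1 <= K) ->
  lebesgue_measure (windows K j0 ws) =
  (\sum_(p <- ws) if p.2 then p.1 else K - p.1)%:E.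
Proof.
move=> K0; elim: ws j0 => [|p ws IH] j0 h.
  rewrite big_nil (_ : windows _ _ _ = set0) ?measure0 //.
  by apply/seteqP; split=> // t [].
have hp : 0 <= p.1 <= K by apply: h; rewrite inE eqxx.
have hws q : q \in ws -> 0 <= q.1 <= K by move=> qw; apply: h; rewrite inE qw orbT.
rewrite big_cons EFinD -(IH j0.+1) // -(@lebesgue_window K j0 p hp) windows_cons.
apply: measureU.
- exact: measurable_window.
- exact: measurable_windows.
- apply/seteqP; split=> // t [[/andP[_ h1] _] [j _ [/andP[h2 _] _]]].
  have : j0.+1%:R * K <= (j0.+1 + j)%:R * K by rewrite ler_wpM2r // ler_nat leq_addr.
  by rewrite leNgt (le_lt_trans h2).
Qed.

Lemma window_exists (K : R) (m : nat) (t : R) : 0 <= t < m%:R * K ->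
  exists2 j, (j < m)%N & j%:R * K <= t < j.+1%:R * K.
Proof.
elim: m => [|m IH]; first by rewrite mul0r => /andP[]; lra.
move=> /andP[t0 tm]; have [h|h] := ltP t (m%:R * K).
  by have [|j jm hj] := IH; [rewrite t0|exists j => //; exact: leqW].
by exists m => //; rewrite h tm.
Qed.

Lemma window_uniq (K : R) (i j : nat) (t : R) : 0 < K ->
  i%:R * K <= t < i.+1%:R * K -> j%:R * K <= t < j.+1%:R * K -> i = j.
Proof.
move=> K0 /andP[hi hi'] /andP[hj hj'].
apply/eqP; rewrite eqn_leq; apply/andP; split; rewrite -ltnS -(ltr_nat R).
  by rewrite -(ltr_pM2r K0) (le_lt_trans hi).
by rewrite -(ltr_pM2r K0) (le_lt_trans hj).
Qed.

End Windows.

Section UniformMeasurable.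
Context (R : realType).

(** Monotone in [r], hence measurable. A uniform delay depends on the state only through the length
    of its interval, so this yields the measurability of the delay measures. *)
Lemma measurable_lebesgue_below (B : set R) : measurable B ->
  measurable_fun setT (fun r : R => fine (lebesgue_measure (B `&` `[0, r[%classic))).
Proof.
move=> mB; apply: nondecreasing_measurable => // r r' rr'.
have fin (x : R) : (lebesgue_measure (B `&` `[0%R, x[%classic) < +oo)%E.
  apply: (@le_lt_trans _ _ (lebesgue_measure (`[0%R, x[%classic : set R))).
    by apply: le_measure; rewrite ?inE //; exact: measurableI.
  by rewrite lebesgue_measure_itv /=; case: ifP => // _; rewrite -EFinD ltry.
apply: fine_le.
- by rewrite ge0_fin_numE // fin.
- by rewrite ge0_fin_numE // fin.
- apply: le_measure; rewrite ?inE; [exact: measurableI|exact: measurableI|].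
  apply: setIS => x /=; rewrite !in_itv /= => /andP[-> h] /=.
  exact: lt_le_trans rr'.
Qed.

End UniformMeasurable.

(** * The game of a program *)

Section Arena.
Variables (P : qprog) (np K : nat).

(* Quantity [i] is the difference of the clocks [2i] and [2i+1], and clock
   [2np] measures the time spent in Box and stochastic locations. *)
Definition nclk := np.*2.
(** The index in ['I_4] allows for three genuine checks and one more that is always [trivial_test];
    of the two sinks, [locE true] is the target. *)
Definition gloc : finType :=
  ((node P + node P * bool) + (node P * bool * 'I_4 + bool))%type.
Definition locD (x : node P) : gloc := inl (inl x).
Definition locB (x : node P) (b : bool) : gloc := inl (inr (x, b)).
Definition locS (x : node P) (b : bool) (c : 'I_4) : gloc := inr (inl (x, b, c)).
Definition locE (w : bool) : gloc := inr (inr w).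

Definition nlocs := #|gloc|.-1.
Definition enc (l : gloc) : 'I_nlocs.+1 := inord (enum_rank l).
Definition dec (i : 'I_nlocs.+1) : gloc := nth (locE true) (enum gloc) i.

Lemma nlocsS : nlocs.+1 = #|gloc|.
Proof. by rewrite /nlocs prednK //; apply/card_gt0P; exists (locE true). Qed.

Lemma encK : cancel enc dec.
Proof.
move=> l; rewrite /dec /enc inordK; last by rewrite nlocsS.
exact: nth_enum_rank.
Qed.

Lemma decK : cancel dec enc.
Proof.
move=> i; apply: val_inj; rewrite /enc /= inordK; last by rewrite nlocsS.
have im : (i < #|gloc|)%N by rewrite -nlocsS.
rewrite /dec; have -> : nth (locE true) (enum gloc) i = enum_val (Ordinal im).
  by rewrite /enum_val; apply: set_nth_default; rewrite -cardE.
by rewrite enum_valK.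
Qed.

Definition cl (c : nat) : 'I_nclk.+1 := inord c.
Definition resetting (cs : seq nat) : {set 'I_nclk.+1} :=
  [set c : 'I_nclk.+1 | val c \in cs]%SET.

(** The two clocks of a quantity get windows of opposite polarity, since one enters the balance with
    the opposite sign of the other. *)
Definition wins (t : test) : seq (nat * bool) :=
  flatten [seq [:: (p.1.*2, p.2); (p.1.*2.+1, ~~ p.2)] | p <- t].
Definition stest (x : node P) (b : bool) (c : nat) : seq (nat * bool) := wins (nth_test x b c).

Definition win_guard (j : nat) (c : nat) (be : bool) : constraint nclk.+1 :=
  [:: (cl nclk, CGe, (j * K)%N); (cl nclk, CLt, (j.+1 * K)%N);
      (cl c, if be then CGe else CLt, (j.+1 * K)%N)].

(** Both results of the clock comparison have an edge, so exactly one edge is enabled at each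
    possible delay; the target is entered if the result agrees with the polarity. *)
Definition win_edge (x : node P) (b : bool) (c : 'I_4) (j : nat) (be : bool) :=
  let p := nth (0%N, true) (stest x b c) j in
  Edge (enc (locS x b c)) (win_guard j p.1 be) finset.set0 (enc (locE (be == p.2))).

Definition free_edge (l : gloc) (C : seq nat) (l' : gloc) : edge nlocs nclk.+1 :=
  Edge (enc l) [::] (resetting C) (enc l').
Definition edgeDB x b := free_edge (locD x) [:: (wr x).*2.+1; nclk] (locB x b).
Definition edgeBS x b c := free_edge (locB x b) [::] (locS x b c).
Definition edgeBD x b x' := free_edge (locB x b) [:: (wr x').*2] (locD x').

(* In every Diamond or Box location the first edge is one that can always be
   taken immediately. *)
Definition out (l : gloc) : seq (edge nlocs nclk.+1) :=
  match l with
  | inl (inl x) => free_edge l [::] (locE false)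
      :: [seq edgeDB x b | b <- [:: true; false] & en x b]
  | inl (inr (x, b)) =>
      (if nx x b is Some x' then edgeBD x b x' else edgeBS x b ord_max)
      :: [seq edgeBS x b c | c <- enum 'I_4]
  | inr (inl (x, b, c)) =>
      [seq win_edge x b c j true | j <- iota 0 (size (stest x b c))] ++
      [seq win_edge x b c j false | j <- iota 0 (size (stest x b c))]
  | inr (inr w) => [:: free_edge l [::] l]
  end.

Definition all_clocks : constraint nclk.+1 := [seq (c, CLe, K) | c <- enum 'I_nclk.+1].

(** Clock [nclk] is reset on the way to Box, so Box cannot let time pass and a draw starts with this
    clock at 0. The bound [K] on all clocks ensures that each value fits into its window. *)
Definition ginv (l : gloc) : constraint nclk.+1 :=
  match l with
  | inl (inl _) => all_clocks
  | inl (inr _) => (cl nclk, CLe, 0%N) :: all_clocks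
  | inr (inl (x, b, c)) => [:: (cl nclk, CLt, (size (stest x b c) * K)%N)]
  | inr (inr _) => [::]
  end.

Definition gowner (l : gloc) : player :=
  match l with
  | inl (inl _) | inr (inr _) => Diamond
  | inl (inr _) => Box
  | inr (inl _) => Stochastic
  end.

Definition arena_of : arena nlocs nclk.+1 :=
  Arena (TimedAutomaton (undup (flatten [seq out l | l <- enum gloc])) (fun i => ginv (dec i)))
        (fun i => gowner (dec i)) (fun=> 1%N).
Local Notation G := arena_of.

Lemma outSP x b (c : 'I_4) (e : edge nlocs nclk.+1) : reflect
  (exists j be, (j < size (stest x b c))%N /\ e = win_edge x b c j be) (e \in out (locS x b c)).
Proof.
apply: (iffP idP) => /=.
  by rewrite mem_cat => /orP[] /mapP[j jw ->]; exists j; [exists true|exists false]; move: jw;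
    rewrite mem_iota.
move=> [j [be [jw ->]]]; rewrite mem_cat; apply/orP.
by case: be; [left|right]; apply: map_f; rewrite mem_iota.
Qed.

Lemma outDP x (e : edge nlocs nclk.+1) : e \in out (locD x) ->
  e = free_edge (locD x) [::] (locE false) \/ exists2 b, en x b & e = edgeDB x b.
Proof.
rewrite -[out _]/(_ :: [seq edgeDB x b | b <- [seq b <- [:: true; false] | en x b]]).
rewrite inE => /predU1P[->|/mapP[b]]; first by left.
by rewrite mem_filter => /andP[xb _] ->; right; exists b.
Qed.

Lemma outD_mem x b : en x b -> edgeDB x b \in out (locD x).
Proof.
move=> xb.
rewrite -[out _]/(_ :: [seq edgeDB x b | b <- [seq b <- [:: true; false] | en x b]]).
by rewrite inE map_f ?orbT // mem_filter xb; case: (b).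
Qed.

Lemma outBP x b (e : edge nlocs nclk.+1) : e \in out (locB x b) ->
  (exists2 x', nx x b = Some x' & e = edgeBD x b x') \/ exists c, e = edgeBS x b c.
Proof.
rewrite /= inE => /predU1P[->|/mapP[c _ ->]]; last by right; exists c.
by case: (nx x b) => [x'|]; [left; exists x'|right; exists ord_max].
Qed.

Lemma out_src l e : e \in out l -> src e = enc l.
Proof.
case: l => [[x|[x b]]|[[[x b] c]|w]] /=.
- by rewrite inE => /predU1P[->|/mapP[b _ ->]].
- rewrite inE => /predU1P[->|/mapP[c _ ->]] //.
  by case: (nx x b).
- by rewrite mem_cat => /orP[] /mapP[j _ ->].
- by rewrite inE => /eqP ->.
Qed.

Lemma edges_out e : (e \in edges G) = (e \in out (dec (src e))).
Proof.
rewrite mem_undup; apply/flattenP/idP => [[_ /mapP[l _ ->] el]|h].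
  by rewrite (out_src el) encK.
by exists (out (dec (src e))) => //; apply/mapP; exists (dec (src e)) => //; rewrite mem_enum.
Qed.

Section Semantics.
Context (R : realType).
Local Notation state := (state R nlocs nclk.+1).
Definition cv (v : valuation R nclk.+1) (c : nat) : R := tnth v (cl c).

Lemma cv_delay v t c : cv (delay v t) c = cv v c + t.
Proof. by rewrite /cv tnth_mktuple. Qed.

Lemma cv_reset v C c : (c <= nclk)%N ->
  cv (reset v (resetting C)) c = if c \in C then 0 else cv v c.
Proof. by move=> cn; rewrite /cv tnth_mktuple inE /= inordK. Qed.

Lemma can_takeP (l : gloc) v t e : can_take G ((enc l, v) : state) (t, e) <->
  [/\ e \in out l, 0 <= t & sat (delay v t) (guard e)] /\
  [/\ sat v (ginv l), sat (delay v t) (ginv l) &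
      sat (reset (delay v t) (resets e)) (ginv (dec (tgt e)))].
Proof.
rewrite /can_take /=; split.
  move=> [[h1 h2 h3] [h4 h5 h6]]; move: h1 h5; rewrite edges_out h2 encK => h1.
  by move=> /(sat_convex _ _ h3)[h5 h5'].
move=> [[h1 h2 h3] [h4 h5 h6]]; rewrite edges_out (out_src h1) encK; split=> //.
by split=> //; apply/(sat_convex _ _ h2).
Qed.

Lemma sat_all_clocks v : sat v all_clocks <-> forall c : 'I_nclk.+1, tnth v c <= K%:R :> R.
Proof.
rewrite /sat /all_clocks all_map; split=> [/allP h c|h]; first by apply: h; rewrite mem_enum.
by apply/allP => c _; exact: h.
Qed.

Definition dflt (i : 'I_nlocs.+1) : move R nlocs nclk.+1 := (0, head point (out (dec i))).

Lemma delay0 (v : valuation R nclk.+1) : delay v 0 = v.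
Proof. by apply: eq_from_tnth => i; rewrite tnth_mktuple addr0. Qed.

Lemma sat_all_reset v C :
  sat (v : valuation R nclk.+1) all_clocks -> sat (reset v C) all_clocks.
Proof.
move=> /sat_all_clocks h; apply/sat_all_clocks => c; rewrite tnth_mktuple.
by case: ifP.
Qed.

Hypothesis K0 : (0 < K)%N.
Hypothesis ts0 : forall x b c, (0 < size (nth_test (x : node P) b c))%N.

Lemma size_wins t : size (wins t) = (size t).*2.
Proof. by elim: t => //= p t ->. Qed.

Lemma dflt_legal (s : state) : is_state G s -> gowner (dec s.1) <> Stochastic ->
  can_take G s (dflt s.1).
Proof.
case: s => i v [v0 /= hinv]; rewrite -[i]decK /dflt /=; move: (dec i) hinv => l.
rewrite /= ?decK ?encK => hinv os; apply/can_takeP; rewrite ?encK.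
case: l hinv os => [[x|[x b]]|[[[x b] c]|w]] //= hinv _.
- by split; split; rewrite ?mem_head ?delay0 ?encK.
- split; split; rewrite ?mem_head ?delay0 ?encK //; first by case: nx.
  case E : (nx x b) => [x'|] /=; rewrite encK /=.
    by apply: sat_all_reset; case/andP: hinv.
  rewrite /sat /= andbT -/(cv _ nclk) cv_reset //= (le_lt_trans (y := 0)) //.
    by case/andP: hinv.
  by rewrite ltr0n muln_gt0 K0 /stest size_wins double_gt0 ts0.
- by split; split; rewrite ?mem_head ?delay0 ?encK.
Qed.

(** * The probability of passing a check *)

Section Draws.
Variables (x : node P) (b : bool) (c : 'I_4) (v : valuation R nclk.+1).
Let ws := stest x b c.
Let W : R := (size ws)%:R * K%:R.
Let z := cv v nclk.
Let s : state := (enc (locS x b c), v).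

Lemma draw_can_take t e : is_state G s -> can_take G s (t, e) <->
  [/\ 0 <= t, z + t < W & exists j be, [/\ (j < size ws)%N, e = win_edge x b c j be,
    j%:R * K%:R <= z + t < j.+1%:R * K%:R &
    (j.+1%:R * K%:R <= cv v (nth (0%N, true) ws j).1 + t) = be]].
Proof.
move=> [v0]; rewrite /= encK /sat /= andbT => zW; split.
  move=> /can_takeP[[/outSP[j [be [jw ->]]] t0 g] [_ h _]].
  move: h g; rewrite /sat /= !andbT -/(cv _ nclk) cv_delay natrM => h.
  rewrite !natrM -[tnth _ _]/(cv (delay v t) _) cv_delay -/ws => /and3P[g1 g2 g3].
  split=> //; exists j, be; split=> //; first by rewrite g1 g2.
  case: be g3 => //= g3; apply/negbTE; rewrite -ltNge; exact: g3.
move=> [t0 h [j [be [jw -> /andP[g1 g2] g3]]]]; apply/can_takeP; split; split=> //.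
- by apply/outSP; exists j, be.
- rewrite /sat /= !natrM -!/(cv _ _) !cv_delay g1 g2 /= andbT -/ws.
  by case: be g3 => //= /negbT; rewrite -ltNge.
- by rewrite /sat /= zW.
- by rewrite /sat /= andbT -/(cv _ nclk) cv_delay natrM.
- by rewrite encK.
Qed.

Lemma draw_delays : is_state G s -> delays G s = `[0, W - z[%classic.
Proof.
move=> hs; apply/seteqP; split=> t /=; rewrite in_itv /=.
  by move=> [e _ /(draw_can_take _ _ hs)[-> h _]] /=; lra.
move=> /andP[t0 tW]; have [_ zW] := hs.
have z0 : 0 <= z by have [h _] := hs; exact: h.
have [|j jw hj] := @window_exists R K%:R (size ws) (z + t); first by rewrite -/W; apply/andP;
  split; lra.
pose be := j.+1%:R * K%:R <= cv v (nth (0%N, true) ws j).1 + t.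
have h : can_take G s (t, win_edge x b c j be).
  by apply/(draw_can_take _ _ hs); split=> //; [lra|exists j, be].
by exists (win_edge x b c j be) => //; case: h => [[]].
Qed.

(** The default is again a [win_edge], so that [sel t] leads to a sink for every real [t], possible
    delay or not. *)
Definition sel (t : R) : edge nlocs nclk.+1 :=
  xget (win_edge x b c 0 true) [set e | can_take G s (t, e)].

Lemma sel_out t : exists j be, sel t = win_edge x b c j be.
Proof.
rewrite /sel; case: xgetP => [e _ /can_takeP[[/outSP[j [be [_ ->]]]]]|_];
  last by exists 0%N, true.
by exists j, be.
Qed.

Lemma draw_uniq t e e' : is_state G s -> can_take G s (t, e) -> can_take G s (t, e') -> e = e'.
Proof.
move=> hs /(draw_can_take _ _ hs)[_ _ [j [be [_ -> h1 h2]]]].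
move=> /(draw_can_take _ _ hs)[_ _ [j' [be' [_ -> h1' h2']]]].
have K0' : 0 < K%:R :> R by rewrite ltr0n.
have jj : j = j' by exact: window_uniq h1 h1'.
by rewrite -h2 -h2' jj.
Qed.

Lemma selP t : is_state G s -> delays G s t -> forall e, can_take G s (t, e) <-> e = sel t.
Proof.
move=> hs [e0 _ he0] e; have h : can_take G s (t, sel t) by
  exact: (@xgetPex _ (win_edge x b c 0 true) [set e | can_take G s (t, e)] (ex_intro _ e0 he0)).
by split=> [he|-> //]; exact: draw_uniq he h.
Qed.

Lemma measurable_edge_delays (e : edge nlocs nclk.+1) : measurable (edge_delays G s e).
Proof.
have mcv (y : 'I_nclk.+1) : measurable_fun setT (fun t : R => tnth (delay v t) y).
  rewrite (_ : (fun t => _) = fun t => tnth v y + t); first exact: measurable_funD.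
  by apply/funext => t; rewrite tnth_mktuple.
have msat cs : measurable [set t | sat (delay v t) cs] by exact: measurable_sat.
have mres : measurable [set t | sat (reset (delay v t) (resets e)) (ginv (dec (tgt e)))].
  apply: measurable_sat => y; have [ye|ye] := boolP (y \in resets e).
    rewrite (_ : (fun t => _) = cst 0); first exact: measurable_cst.
    by apply/funext => t; rewrite tnth_mktuple ye.
  rewrite (_ : (fun t => _) = fun t => tnth (delay v t) y) //.
  by apply/funext => t; rewrite tnth_mktuple (negbTE ye).
have m0 : measurable [set t : R | cmp_holds CGe t 0] by exact: measurable_cmp_holds.
have [h|h] := pselect (e \in out (locS x b c) /\ sat v (ginv (locS x b c))); last first.
  rewrite [X in measurable X](_ : _ = set0) //; apply/seteqP; split=> // t.
  by move=> /can_takeP[[h1 _ _] [h2 _ _]]; apply: h.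
case: h => h1 h2.
rewrite [X in measurable X](_ : _ = [set t : R | cmp_holds CGe t 0] `&`
  ([set t | sat (delay v t) (guard e)] `&`
  ([set t | sat (delay v t) (ginv (locS x b c))] `&`
   [set t | sat (reset (delay v t) (resets e)) (ginv (dec (tgt e)))]))).
  by do 3 (apply: measurableI => //).
apply/seteqP; split=> t; first by move=> /can_takeP[[? ? ?] [? ? ?]]; do !split.
by move=> [? [? [? ?]]]; apply/can_takeP.
Qed.

Lemma measurable_sel (S : set (edge nlocs nclk.+1)) :
  is_state G s -> measurable [set t | S (sel t)].
Proof.
move=> hs; have md : measurable (delays G s) by rewrite draw_delays.
rewrite [X in measurable X](_ : _ = (\bigcup_(e in [set` edges G])
    (edge_delays G s e `&` [set t | S e]))
   `|` (~` delays G s `&` [set t | S (win_edge x b c 0 true)])).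
  apply: measurableU.
    apply: fin_bigcup_measurable => [|e _]; first exact: finite_seq.
    apply: measurableI; first exact: measurable_edge_delays.
    have [h|h] := pselect (S e).
      by rewrite [X in measurable X](_ : _ = setT) //; apply/seteqP; split.
    by rewrite [X in measurable X](_ : _ = set0) //; apply/seteqP; split.
  apply: measurableI; first exact: measurableC.
  have [h|h] := pselect (S (win_edge x b c 0 true)).
    by rewrite [X in measurable X](_ : _ = setT) //; apply/seteqP; split.
  by rewrite [X in measurable X](_ : _ = set0) //; apply/seteqP; split.
have seln t : ~ delays G s t -> sel t = win_edge x b c 0 true.
  move=> nt; rewrite /sel; case: xgetP => // e _ h.
  by exfalso; apply: nt; exists e => //; case: h => [[]].
apply/seteqP; split=> t.
  move=> /= St; have [tV|tV] := pselect (delays G s t); last first.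
    by right; split=> //=; rewrite -(seln t tV).
  left; have h : can_take G s (t, sel t) by apply/(selP hs tV).
  by exists (sel t); [case: h => [[]]|split].
move=> [[e eG [he Se]]|[nt]] /=; last by rewrite seln.
have tV : delays G s t by exists e.
by have /(selP hs tV) <- := he.
Qed.

Let wsv : seq (R * bool) := [seq (cv v p.1, p.2) | p <- ws].

Lemma sel_win : is_state G s -> z = 0 ->
  [set t | tgt (sel t) = enc (locE true)] `&` delays G s = windows K%:R 0 wsv.
Proof.
move=> hs z0.
have nthE j : (j < size ws)%N -> nth (0, false) wsv j =
    (cv v (nth (0%N, true) ws j).1, (nth (0%N, true) ws j).2).
  by move=> jw; rewrite (nth_map (0%N, true)).
apply/seteqP; split=> t /=.
  move=> [tw tV]; have : can_take G s (t, sel t) by apply/(selP hs tV).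
  move=> /(draw_can_take _ _ hs)[_ _ [j [be [jw e h1 h2]]]].
  exists j; rewrite ?size_map // add0n nthE //.
  move: h1; rewrite z0 add0r => h1; split=> //=; rewrite h2.
  by move: tw; rewrite e /= => /(can_inj encK)[/eqP].
move=> [j]; rewrite size_map => jw; rewrite add0n nthE // => -[/= h1 h2].
have h : can_take G s (t, win_edge x b c j (nth (0%N, true) ws j).2).
  apply/(draw_can_take _ _ hs); rewrite z0 add0r; case/andP: (h1) => h3 h4; split.
  - by apply: le_trans h3; apply: mulr_ge0.
  - by apply: (lt_le_trans h4); rewrite ler_wpM2r // ler_nat.
  - by exists j, (nth (0%N, true) ws j).2; split.
have tV : delays G s t by exists (win_edge x b c j (nth (0%N, true) ws j).2) => //;
  case: h => [[]].
split=> //; have /(selP hs tV) <- := h.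
by rewrite /win_edge /= -/ws eqxx.
Qed.

Lemma sum_wins (t : test) :
  \sum_(p <- [seq (cv v p.1, p.2) | p <- wins t]) (if p.2 then p.1 else K%:R - p.1) =
  (size t)%:R * K%:R + balance (fun i => cv v i.*2 - cv v i.*2.+1) t.
Proof.
rewrite /balance; elim: t => [|[i d] t IH]; first by rewrite !big_nil mul0r addr0.
by rewrite /= !big_cons IH /= -natr1 mulrDl mul1r; case: d => /=; ring.
Qed.

Variable (mu : delay_measures R nlocs nclk.+1).
Hypothesis hmu : forall s : state, is_state G s ->
  (0 < lebesgue_measure (delays G s) < +oo)%E -> forall B : set R, measurable B ->
  mu s B = (fine (lebesgue_measure (B `&` delays G s)) /
            fine (lebesgue_measure (delays G s)))%:E.

Lemma lebesgue_delays : is_state G s -> lebesgue_measure (delays G s) = (W - z)%:E.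
Proof.
move=> hs; rewrite draw_delays // lebesgue_measure_itv /= lte_fin ifT;
  first by rewrite -EFinD subr0.
by case: hs => _; rewrite /= encK /sat /= andbT natrM subr_gt0.
Qed.

Lemma draw_room : is_state G s -> 0 < W - z.
Proof. by case=> _; rewrite /= encK /sat /= andbT natrM subr_gt0. Qed.

Lemma draw_mu B : is_state G s -> measurable B ->
  mu s B = (fine (lebesgue_measure (B `&` delays G s)) / (W - z))%:E.
Proof.
move=> hs mB; rewrite hmu //; rewrite lebesgue_delays //.
by rewrite lte_fin ltry draw_room.
Qed.

(** The total length [W] is [2 * size * K], for two windows per term, while the winning windows
    measure [size * K] plus the balance. *)
Lemma draw_win : is_state G s -> z = 0 -> (forall i, cv v i <= K%:R) ->
  mu s [set t | tgt (sel t) = enc (locE true)] =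
  (2^-1 + balance (fun i => cv v i.*2 - cv v i.*2.+1) (nth_test x b c) / W)%:E.
Proof.
move=> hs z0 hK; rewrite draw_mu //;
  last exact: (@measurable_sel [set e | tgt e = enc (locE true)]).
rewrite sel_win // lebesgue_windows //; last first.
  move=> p /mapP[y _ ->] /=; rewrite hK andbT.
  by case: hs => h _; exact: h.
rewrite /wsv /ws /stest sum_wins z0 subr0 /=; congr EFin.
have W0 : W != 0.
  by rewrite mulf_neq0 // pnatr_eq0 -lt0n // /ws /stest size_wins double_gt0.
have K0' : K%:R != 0 :> R by rewrite pnatr_eq0 -lt0n.
rewrite mulrDl; congr (_ + _); rewrite /W /ws /stest size_wins -mul2n natrM.
have t0 : (size (nth_test x b c))%:R != 0 :> R by rewrite pnatr_eq0 -lt0n.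
by field; rewrite t0 K0'.
Qed.

Lemma draw_mu1 : is_state G s -> mu s (delays G s) = 1%E.
Proof.
move=> hs; rewrite draw_mu ?setIid ?lebesgue_delays //; last by rewrite draw_delays.
by rewrite /= divff // gt_eqF // draw_room.
Qed.

Lemma draw_null (N : set R) : is_state G s -> measurable N -> N `<=` delays G s ->
  mu s N = 0%E <-> lebesgue_measure N = 0%E.
Proof.
move=> hs mN NV; rewrite draw_mu // (setIidl NV).
have fN : lebesgue_measure N \is a fin_num.
  rewrite ge0_fin_numE // (@le_lt_trans _ _ (lebesgue_measure (delays G s))) //.
    by apply: le_measure; rewrite ?inE // draw_delays.
  by rewrite lebesgue_delays // ltry.
have r0 := draw_room hs; split=> [[] /eqP|->]; last by rewrite /= mul0r.
rewrite mulf_eq0 invr_eq0 [X in _ || X]gt_eqF // orbF => /eqP h.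
by rewrite -(fineK fN) h.
Qed.

End Draws.

Lemma arena_is_stg (mu : delay_measures R nlocs nclk.+1) :
  (forall s : state, is_state G s ->
  (0 < lebesgue_measure (delays G s) < +oo)%E -> forall B : set R, measurable B ->
  mu s B = (fine (lebesgue_measure (B `&` delays G s)) /
            fine (lebesgue_measure (delays G s)))%:E) -> is_stg G mu.
Proof.
move=> hmu; split.
- exact: undup_uniq.
- by [].
- case=> i v; rewrite /= -[i]decK encK; case: (dec i) => [[x|[x b]]|[[[x b] c]|w]] // hs _.
  split; first exact: draw_mu1.
  by move=> _ N mN NV; exact: draw_null.
- move=> i; rewrite /= -[i]decK encK; case: (dec i) => [[x|[x b]]|[[[x b] c]|w]] // _ B mB mD.
  pose W : R := (size (stest x b c))%:R * K%:R.
  pose F r := fine (lebesgue_measure (B `&` `[0, r[%classic)).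
  have mz : measurable_fun [set v : valuation R nclk.+1 | is_state G (enc (locS x b c), v)]
      (fun v => W - cv v nclk).
    apply: measurable_funB; first exact: measurable_cst.
    by apply: measurable_funTS; exact: measurable_tnth.
  (* The uniform law is a quotient of functions of [W - z]; the positive denominator is inverted as
     a real power. *)
  apply: (@eq_measurable_fun _ _ _ _ _ (fun v => (F (W - cv v nclk) * (W - cv v nclk) `^
    (-1))%:E)).
    move=> v; rewrite inE /= => hs; rewrite draw_mu // draw_delays // powR_inv1 //.
    exact/ltW/draw_room.
  apply/measurable_EFinP; apply: measurable_funM.
    exact: (measurableT_comp (measurable_lebesgue_below mB) mz).
  exact: (measurableT_comp (measurable_powR (-1)) mz).
  exact: mD.
Qed.

End Semantics.
End Arena.

(** * Who wins the game of a program *)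

Section Winning.
Context (R : realType) (P : qprog) (np K : nat).
Local Notation G := (@arena_of P np K).
Local Notation state := (state R (nlocs P) (nclk np).+1).
Local Notation move := (move R (nlocs P) (nclk np).+1).
Local Notation z := (nclk np).
Local Notation locE := (@locE P).
Local Notation dfl := (@dflt P np K R).
Variable (mu : delay_measures R (nlocs P) (nclk np).+1).
Hypothesis K0 : (0 < K)%N.
Hypothesis ts0 : forall (x : node P) b c, (0 < size (nth_test x b c) <= 3)%N.
Hypothesis ts3 : forall (x : node P) b, (size (ts x b) <= 3)%N.
Hypothesis tsnp : forall (x : node P) b c p, p \in nth_test x b c -> (p.1 < np)%N.
Hypothesis wrnp : forall x : node P, (wr x < np)%N.
Hypothesis hmu : forall s : state, is_state G s ->
  (0 < lebesgue_measure (delays G s) < +oo)%E -> forall B : set R, measurable B ->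
  mu s B = (fine (lebesgue_measure (B `&` delays G s)) /
            fine (lebesgue_measure (delays G s)))%:E.

Let ts0' (x : node P) b c : (0 < size (nth_test x b c))%N.
Proof. by case/andP: (@ts0 x b c). Qed.

Definition diffs (v : valuation R (nclk np).+1) (i : nat) : R := cv v i.*2 - cv v i.*2.+1.

(** The quantity about to be overwritten is left free. Its first clock has just been reset and thus
    measures Diamond's delay; its second clock is reset at the end of the delay, so the difference
    becomes that delay. *)
Definition shows (x : node P) (v : valuation R (nclk np).+1) (q : nat -> R) : Prop :=
  (forall i, (i < np)%N -> i != wr x -> diffs v i = q i) /\ cv v (wr x).*2 = 0.

Lemma balance_ext (q q' : nat -> R) (x : node P) b c :
  (forall i, (i < np)%N -> q i = q' i) ->
  balance q (nth_test x b c) = balance q' (nth_test x b c).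
Proof.
by move=> h; rewrite /balance; apply: eq_big_seq => p /tsnp pn; rewrite h.
Qed.

Lemma post_write (x : node P) v q d : shows x v q ->
  let v' := reset (delay v d) (resetting np [:: (wr x).*2.+1; z]) in
  (forall i, (i < np)%N -> diffs v' i = write q (wr x) d i) /\ cv v' z = 0.
Proof.
move=> [h h0] /=; have wx := wrnp x; split; last first.
  by rewrite cv_reset //= !inE eqxx orbT.
move=> i inp; rewrite /diffs !cv_reset /nclk; [|lia|lia].
rewrite !inE !cv_delay /write.
have -> : (i.*2 == (wr x).*2.+1) = false by apply/eqP; lia.
have -> : (i.*2 == np.*2) = false by apply/eqP; lia.
have -> : (i.*2.+1 == np.*2) = false by apply/eqP; lia.
rewrite eqSS -!muln2 eqn_mul2r !muln2 /= orbF; case: eqVneq => [->|ne].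
  by rewrite h0; ring.
by rewrite -(h _ inp ne) /diffs; ring.
Qed.

Lemma shows_next (x' : node P) v q : (forall i, (i < np)%N -> diffs v i = q i) ->
  shows x' (reset (delay v 0) (resetting np [:: (wr x').*2])) q.
Proof.
move=> h; have wx := wrnp x'; split=> [i inp ne|]; last by rewrite cv_reset ?inE ?eqxx ?/nclk;
  [|lia].
rewrite -h // /diffs !cv_reset /nclk; [|lia|lia]; rewrite !inE delay0.
have -> : (i.*2 == (wr x').*2) = false by apply/eqP; move: ne => /eqP; lia.
by have -> : (i.*2.+1 == (wr x').*2) = false by apply/eqP; lia.
Qed.

Lemma box_time (x : node P) b v t e : can_take G ((enc (locB x b), v) : state) (t, e) ->
  is_state G ((enc (locB x b), v) : state) -> t = 0.
Proof.
move=> /can_takeP[[_ t0 _] [_ h _]] [v0 _]; move: h; rewrite /sat /= => /andP[+ _].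
rewrite -/(cv _ z) cv_delay => h; have := v0 (cl np z); rewrite -/(cv _ _) /=; lra.
Qed.

Lemma end_absorbing w be m j (s0 : state) : infinite_runs G s0 w ->
  (state_at s0 m w).1 = enc (locE be) -> (state_at s0 (j + m) w).1 = enc (locE be).
Proof.
rewrite infinite_runsE => hw hm; elim: j => // j IH.
have := hw (j + m)%N I; rewrite /= addSn state_atS; move: IH.
case: (state_at s0 (j + m) w) => i v /= ->; case: (w (j + m)%N) => t e.
by move=> /can_takeP[[/= + _ _] _]; rewrite inE => /eqP ->.
Qed.

(** * If the machine does not halt, Box refutes every strategy of Diamond *)

Section DiamondLoses.
Variables (Inv : node P -> (nat -> R) -> Prop) (x0 : node P) (q0 : nat -> R).
Variables (v0 : valuation R (nclk np).+1) (D : R).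
Hypothesis Inv0 : Inv x0 q0.
Hypothesis Inv_step : forall x q d b, Inv x q -> 0 <= d -> en x b ->
  passes (write q (wr x) d) x b ->
  exists2 x', nx x b = Some x' & Inv x' (write q (wr x) d).
Let s0 : state := (enc (locD x0), v0).
Hypotheses (hs0 : is_state G s0) (shows0 : shows x0 v0 q0).

(** The states met while Box takes its first edge and no check is violated; the last case is Diamond
    giving up. *)
Definition good (s : state) : Prop :=
  [\/ exists x v q, [/\ s = (enc (locD x), v), shows x v q & Inv x q],
      exists x b v q d, [/\ s = (enc (locB x b), v), [/\ en x b, 0 <= d & Inv x q] &
                            forall i, (i < np)%N -> diffs v i = write q (wr x) d i] |
      exists v, s = (enc (locE false), v)].

Definition bad (s : state) : Prop := exists x b c v,
  s = (enc (locB x b), v) /\ balance (diffs v) (nth_test x b c) < 0.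

Lemma good_owner s : good s -> gowner (dec s.1) <> Stochastic.
Proof.
by case=> [[x [v [q [-> _ _]]]]|[x [b [v [q [d [-> _ _]]]]]]|[v ->]]; rewrite /= encK.
Qed.

Lemma good_step s m : good s -> ~ bad s -> can_take G s m ->
  (gowner (dec s.1) = Box -> m = dfl s.1) -> good (post s m).
Proof.
case: m => t e [[x [v [q [-> hv hI]]]]|[x [b [v [q [d [-> [ex d0 hI] hv]]]]]]|[v ->]] nbad.
- move=> /can_takeP[[/outDP[->|[b exb ->]] t0 _] _] _.
    by constructor 3; eexists.
  constructor 2; exists x, b; eexists; exists q, t; split=> //.
  by case: (post_write t hv).
- move=> _ h; have -> : (t, e) = dfl (enc (locB x b)) by apply: h; rewrite /= encK.
  have hp : passes (write q (wr x) d) x b.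
    move=> c; rewrite -(@balance_ext (diffs v)) // leNgt; apply/negP => hc.
    by apply: nbad; exists x, b, c, v.
  have [x' E hI'] := Inv_step hI d0 ex hp.
  constructor 1; rewrite /post /= encK /= E /=; exists x'; eexists; exists (write q (wr x) d);
    split=> //.
  exact: shows_next.
- move=> /can_takeP[[/= + t0 _] _] _; rewrite inE => /eqP ->.
  by constructor 3; eexists.
Qed.

Section Strategy.
Variable sD : strategy R (nlocs P) (nclk np).+1.
Hypothesis hsD : is_strategy G s0 Diamond sD.

Definition next_move (h : seq move) : move :=
  if gowner (dec (last_state s0 h).1) is Diamond then sD h else dfl (last_state s0 h).1.
Fixpoint hist (m : nat) : seq move :=
  if m is m'.+1 then rcons (hist m') (next_move (hist m')) else [::].

Lemma size_hist m : size (hist m) = m.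
Proof. by elim: m => //= m IH; rewrite size_rcons IH. Qed.

Lemma take_hist i m : (i <= m)%N -> take i (hist m) = hist i.
Proof.
elim: m => [|m IH]; first by rewrite leqn0 => /eqP ->.
rewrite leq_eqVlt => /predU1P[->|im]; first by rewrite take_oversize // size_hist.
by rewrite /= -cats1 takel_cat ?size_hist // IH.
Qed.

Lemma hist_good m : (forall i, (i < m)%N -> ~ bad (last_state s0 (hist i))) ->
  is_run G s0 (hist m) /\ good (last_state s0 (hist m)).
Proof.
elim: m => [|m IH] nb.
  by split=> //; constructor 1; exists x0, v0, q0.
have [|hr hg] := IH; first by move=> i im; apply: nb; exact: ltnW.
have hs := is_run_is_state hs0 hr.
have hc : can_take G (last_state s0 (hist m)) (next_move (hist m)).
  rewrite /next_move; case E : (gowner _).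
  - exact: dflt_legal (good_owner hg).
  - by apply: hsD.1; split.
  - exact: dflt_legal (good_owner hg).
split; first by apply/is_run_rcons.
rewrite /= last_state_rcons; apply: good_step => //; first exact: nb.
by rewrite /next_move => ->.
Qed.

Lemma hist_notin m : (forall i, (i < m)%N -> ~ bad (last_state s0 (hist i))) ->
  (last_state s0 (hist m)).1 \notin [set enc (locE true)]%SET.
Proof.
move=> /hist_good[_ hg]; rewrite inE; apply/eqP => /(congr1 (@dec _)).
by case: hg => [[x [v [q [-> _ _]]]]|[x [b [v [q [d [-> _ _]]]]]]|[v ->]]; rewrite /= !encK.
Qed.

Lemma dflt_box_legal h : player_runs G s0 Box h ->
  can_take G (last_state s0 h) (dfl (last_state s0 h).1).
Proof.
move=> [hr ho]; apply: dflt_legal => //; first exact: is_run_is_state hs0 hr.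
by move: ho => /= ->.
Qed.

Lemma det_hist pi m : (forall i, (i < m)%N -> ~ bad (last_state s0 (hist i))) ->
  (forall i, (i < size pi)%N -> (i < m)%N -> nth point pi i = next_move (hist i)) ->
  (forall i, (i < size pi)%N -> (i < m)%N -> take i pi = hist i) ->
  det_play G s0 sD (follow s0 pi dfl) (hist m).
Proof.
move=> nb hn ht i; rewrite size_hist => im; rewrite take_hist ?(ltnW im) //.
have [_ /good_owner hg] : is_run G s0 (hist i) /\ good (last_state s0 (hist i)).
  by apply: hist_good => j ji; apply: nb; exact: ltn_trans im.
have -> : nth point (hist m) i = next_move (hist i).
  have -> : nth point (hist m) i = nth point (take i.+1 (hist m)) i by rewrite nth_take.
  by rewrite take_hist //= nth_rcons size_hist ltnn eqxx.
rewrite /det_move /next_move /=; case E : (gowner _) hg => // _.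
congr Some; rewrite /follow size_hist; case: ifP => // /andP[ip _].
by rewrite hn // /next_move E.
Qed.

(** Without a violated check the invariant always provides a next node, so the play goes on forever
    or enters the losing sink, and the target is never reached. *)
Lemma safe_counter : (forall m, ~ bad (last_state s0 (hist m))) ->
  exists2 sB, is_strategy G s0 Box sB &
  forall Pr, induces G mu s0 sD sB Pr ->
    (Pr (reach G s0 [set enc (locE true)]%SET D) < (2^-1)%:E)%E.
Proof.
move=> nb; exists (follow s0 [::] dfl).
  by apply: follow_strategy => //; exact: dflt_box_legal.
move=> Pr hPr; rewrite (prob_reach_never hPr D size_hist) ?lte_fin ?invr_gt0 //.
  by move=> m; apply: det_hist.
by move=> m; apply: hist_notin.
Qed.

(** Box repeats its first edges up to the first violated check and then takes that check. All before
    the draw is deterministic, so the draw alone bounds the probability. *)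
Lemma check_counter j : bad (last_state s0 (hist j)) ->
  (forall i, (i < j)%N -> ~ bad (last_state s0 (hist i))) ->
  exists2 sB, is_strategy G s0 Box sB &
  forall Pr, induces G mu s0 sD sB Pr ->
    (Pr (reach G s0 [set enc (locE true)]%SET D) < (2^-1)%:E)%E.
Proof.
move=> [x [b [c [v [hl hb]]]]] nb; have [hr hg] := hist_good nb.
have hs := is_run_is_state hs0 hr; rewrite hl in hs.
(* A larger index would denote [trivial_test], whose balance is not negative. *)
have c4 : (c < 4)%N.
  rewrite ltnNge; apply/negP => c4; move: hb; rewrite /nth_test nth_default.
    by rewrite /balance /= !big_cons big_nil /= addr0 subrr ltxx.
  exact: leq_trans (ts3 _ _) (ltnW c4).
pose c' : 'I_4 := Ordinal c4; pose mv : move := (0, edgeBS np x b c').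
pose pi := rcons (hist j) mv; have spi : size pi = j.+1 by rewrite size_rcons size_hist.
have hv0 : reset v (resetting np [::]) = v.
  by apply: eq_from_tnth => i; rewrite tnth_mktuple inE in_nil.
have lpi : last_state s0 pi = (enc (locS x b c'), v).
  by rewrite last_state_rcons hl /post /= delay0 hv0.
have vz : cv v z = 0.
  by apply/le_anti; case: hs => h1 /=; rewrite encK /sat /= => /andP[-> _] /=; exact: h1.
have hc : can_take G (last_state s0 (hist j)) mv.
  rewrite hl; apply/can_takeP; case: hs => h1 /=; rewrite encK => h2; split; split=> //.
  - by rewrite inE; apply/orP; right; apply: map_f; rewrite mem_enum.
  - by rewrite delay0.
  rewrite /mv /= delay0 hv0 encK /sat /= andbT -/(cv _ z) vz ltr0n muln_gt0 K0 andbT.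
  by rewrite size_wins double_gt0.
have hrpi : is_run G s0 pi by apply/is_run_rcons.
have hspi := is_run_is_state hs0 hrpi; rewrite lpi in hspi.
have tpi i : (i <= j)%N -> take i pi = hist i.
  by move=> ij; rewrite /pi -cats1 takel_cat ?size_hist // take_hist.
have npi i : (i < j)%N -> nth point pi i = next_move (hist i).
  move=> ij; have -> : nth point pi i = nth point (take i.+1 pi) i by rewrite nth_take.
  by rewrite tpi //= nth_rcons size_hist ltnn eqxx.
exists (follow s0 pi dfl).
  by apply: follow_strategy => //; exact: dflt_box_legal.
move=> Pr hPr.
have hdet : det_play G s0 sD (follow s0 pi dfl) pi.
  apply/det_play_rcons; split; first by apply: det_hist => // i _ ij;
    [exact: npi|exact: tpi (ltnW ij)].
  rewrite /det_move hl /= encK /follow size_hist spi ltnSn tpi // eqxx /=.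
  by rewrite /pi nth_rcons size_hist ltnn eqxx.
have mB : measurable [set y : move | tgt y.2 = enc (locE true)].
  exact: (@measurable_move_edge _ _ _ [set e | tgt e = enc (locE true)]).
apply: le_lt_trans (prob_reach_draw hPr hdet mB _) _.
  move=> w [hw [m [hm _]]]; rewrite spi => hpi.
  (* The target is visited neither before the draw nor at the stochastic location. Afterwards the
     play stays in the sink it entered, so the drawn label itself must lead to the target. *)
  have [mj|mj] := leqP m j.
    have := hist_notin (fun i im => nb i (leq_trans im mj)).
    by rewrite -(tpi _ mj) -hpi take_run_prefix ?hm // leqW.
  have [mj'|mj'] := leqP m j.+1.
    have em : m = j.+1 by lia.
    by move: hm; rewrite em hpi lpi inE => /eqP /(can_inj (@encK _)).
  have : can_take G (state_at s0 j.+1 w) (w j.+1) by have := hw;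
    rewrite infinite_runsE => /(_ j.+1 I).
  rewrite /state_at hpi lpi; case ew: (w j.+1) => [t e].
  move=> /can_takeP[[/outSP[j' [be [_ ee]]] _ _] _].
  have := @end_absorbing w (be == (nth (0%N, true) (stest x b c') j').2) j.+2 (m - j.+2) s0 hw.
  rewrite state_atS ew ee subnK // => /(_ erefl) hm'.
  move: hm; rewrite inE -/(state_at s0 m w) hm' => /eqP /(can_inj (@encK _))[be1].
  by rewrite /= be1.
rewrite (@step_law_draw _ _ _ _ _ _ (enc (locS x b c'), v) (sel K x b c' v)) //; last first.
- by move=> t ht e; exact: selP.
- by move=> S; exact: measurable_sel.
- exact: draw_mu1.
- by rewrite draw_delays.
- by rewrite /= encK.
- exact: undup_uniq.
rewrite draw_win //; last first.
  case: hs => _ /=; rewrite encK /sat /= => /andP[_ /sat_all_clocks h] i; exact: h.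
rewrite lte_fin -[ltRHS]addr0 ltrD2l pmulr_llt0 // invr_gt0 mulr_gt0 // ltr0n //.
by rewrite /stest size_wins double_gt0.
Qed.

End Strategy.

Lemma diamond_loses : ~ diamond_wins G mu s0 [set enc (locE true)]%SET D CGe 2^-1.
Proof.
move=> [sD hsD hB].
have [sB hsB h] : exists2 sB, is_strategy G s0 Box sB &
  forall Pr, induces G mu s0 sD sB Pr ->
    (Pr (reach G s0 [set enc (locE true)]%SET D) < (2^-1)%:E)%E.
  have [ex|nex] := pselect (exists j, bad (last_state s0 (hist sD j))).
    have ex' : exists j, `[< bad (last_state s0 (hist sD j)) >].
      by case: ex => j hj; exists j; apply/asboolP.
    case: (ex_minnP ex') => j /asboolP hj hmin; apply: (check_counter hsD hj) => i ij hi.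
    by have := hmin i; rewrite leqNgt ij => /(_ (introT (asboolP _) hi)).
  by apply: (safe_counter hsD) => m hm; apply: nex; exists m.
have [Pr hPr /= hge] := hB sB hsB.
by have := h Pr hPr; rewrite ltNge hge.
Qed.

End DiamondLoses.

(** * If the machine halts, the correct simulation wins *)

Section DiamondWins.
Variables (x0 : node P) (q0 : nat -> R) (l0 : seq (R * bool)).
Variables (v0 : valuation R (nclk np).+1) (D Tm : R).
Let s0 : state := (enc (locD x0), v0).
Hypotheses (hs0 : is_state G s0) (shows0 : shows x0 v0 q0) (play0 : play x0 q0 l0).
Hypotheses (v0le : forall c, tnth v0 c <= 1) (suml0 : \sum_(p <- l0) p.1 <= Tm).
Hypotheses (TmK : 1 + Tm <= K%:R) (TmD : Tm + 6 * K%:R <= D).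

Fixpoint moves (x : node P) (l : seq (R * bool)) : seq move :=
  if l is (d, b) :: l' then
    (d, edgeDB np x b) ::
    (if nx x b is Some x' then (0, edgeBD np x b x') :: moves x' l'
     else [:: (0, edgeBS np x b ord_max)])
  else [::].

Let pi0 := moves x0 l0.
Let sD := follow s0 pi0 dfl.

(** By the last clause [pi'] is not a proper prefix of [pi0]; hence [sD] has nothing left to replay
    after the draw and loops in the sink. *)
Definition drawing sB pi' x b c v' : Prop :=
  [/\ [/\ det_play G s0 sD sB pi', is_run G s0 pi' &
      last_state s0 pi' = (enc (locS x b c), v')],
    is_state G ((enc (locB x b), v') : state), 0 <= balance (diffs v') (nth_test x b c),
    \sum_(y <- pi') y.1 <= Tm &
    ~ ((size pi' < size pi0)%N /\ pi' = take (size pi') pi0)].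

Lemma is_state_clocks (x : node P) b v : is_state G ((enc (locB x b), v) : state) -> cv v z = 0.
Proof.
by case=> h1 /=; rewrite encK /sat /= => /andP[h _]; apply/le_anti; rewrite h /=; exact: h1.
Qed.

Lemma post_S (x : node P) b c v : post ((enc (locB x b), v) : state) (0, edgeBS np x b c) =
  (enc (locS x b c), v).
Proof.
rewrite /post /= delay0; congr (_, _).
by apply: eq_from_tnth => i; rewrite tnth_mktuple inE in_nil.
Qed.

(** A clock is at most 1 plus the elapsed time, hence at most [1 + Tm <= K], and the invariant holds
    during the write. *)
Lemma legal_write x v d b h q : en x b -> 0 <= d -> shows x v q ->
  last_state s0 h = (enc (locD x), v) -> is_run G s0 h ->
  (forall c, tnth v c <= 1 + \sum_(y <- h) y.1) -> \sum_(y <- h) y.1 + d <= Tm ->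
  can_take G (last_state s0 h) (d, edgeDB np x b).
Proof.
move=> xb d0 hv hl hr hc hT; rewrite hl.
have hK t : 0 <= t <= d -> sat (delay v t) (all_clocks np K).
  move=> /andP[t0 td]; apply/sat_all_clocks => c; rewrite tnth_mktuple.
  by have := hc c; have := TmK; lra.
apply/can_takeP; split; split=> //.
- exact: outD_mem.
- by rewrite -[v]delay0; apply: hK; rewrite lexx d0.
- by apply: hK; rewrite lexx d0.
- rewrite encK; have [_ vz] := post_write d hv.
  have hr' : sat (reset (delay v d) (resetting np [:: (wr x).*2.+1; z])) (all_clocks np K).
    by apply: sat_all_reset; apply: hK; rewrite lexx d0.
  by apply/andP; split=> //=; rewrite -/(cv _ z) vz.
Qed.

Lemma dflt_diamond_legal h : player_runs G s0 Diamond h ->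
  can_take G (last_state s0 h) (dfl (last_state s0 h).1).
Proof.
move=> [hr ho]; apply: dflt_legal => //; first exact: is_run_is_state hs0 hr.
by move: ho => /= ->.
Qed.

Lemma play_ge0 (x : node P) q l : play x q l -> 0 <= \sum_(p <- l) p.1 :> R.
Proof.
elim: l x q => // -[d b] l IH x q /= [d0 _ _]; rewrite big_cons.
case: (nx x b) => [x'|->]; last by rewrite big_nil addr0.
by move=> /IH h; exact: addr_ge0.
Qed.

Lemma run_ge0 (s : state) h : is_run G s h -> 0 <= \sum_(y <- h) y.1.
Proof.
elim: h s => [|y h IH] s; first by rewrite big_nil.
by move=> /= [[[_ _ y0] _] /IH hr]; rewrite big_cons addr_ge0.
Qed.

Lemma moves_legal l x q h v :
  play x q l -> is_run G s0 h ->
  last_state s0 h = (enc (locD x), v) -> shows x v q ->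
  (forall c, tnth v c <= 1 + \sum_(y <- h) y.1) ->
  \sum_(y <- h) y.1 + \sum_(p <- l) p.1 <= Tm -> is_run G s0 (h ++ moves x l).
Proof.
elim: l x q h v => // -[d b] l IH x q h v /= [d0 xb hp hnx] hr hl hv hc.
rewrite big_cons /= => hT.
have suml : 0 <= \sum_(p <- l) p.1.
  by case: (nx x b) hnx => [x'|->]; [exact: play_ge0|rewrite big_nil].
have [dv1 z1] := post_write d hv.
set v1 := reset _ _ in dv1 z1.
pose m1 : move := (d, edgeDB np x b).
have r1 : is_run G s0 (rcons h m1).
  by apply/is_run_rcons; split=> //; apply: legal_write hl hr hc _ => //; [exact: hv|lra].
have l1 : last_state s0 (rcons h m1) = (enc (locB x b), v1) by rewrite last_state_rcons hl.
have s1 := is_run_is_state hs0 r1.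
pose m2 := dfl (last_state s0 (rcons h m1)).1.
have r2 : is_run G s0 (rcons (rcons h m1) m2).
  by apply/is_run_rcons; split=> //; apply: dflt_legal => //; rewrite l1 /= encK.
have m2E : m2 = (0, if nx x b is Some x' then edgeBD np x b x' else edgeBS np x b ord_max).
  by rewrite /m2 l1 /dflt /= encK.
have sum2 : \sum_(y <- rcons (rcons h m1) m2) y.1 = \sum_(y <- h) y.1 + d.
  by rewrite -!cats1 !big_cat !big_seq1 m2E /= addr0.
case E : (nx x b) hnx m2E => [x'|] hnx m2E; last first.
  by rewrite -m2E -cat_rcons -cat_rcons cats0.
rewrite -m2E -!cat_rcons.
apply: (IH x' (write q (wr x) d) _ (reset (delay v1 0) (resetting np [:: (wr x').*2]))) => //.
- by rewrite last_state_rcons l1 m2E.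
- exact: shows_next.
- move=> i; rewrite sum2 !tnth_mktuple addr0; have := hc i; have := run_ge0 hr.
  by case: ifP => _; [lra|case: ifP => _; lra].
- by rewrite sum2; lra.
Qed.

(** Box cannot delay; it either continues along [pi0] or starts a check. The list [l] is finite and
    its end forces a check, so one is eventually started, with nonnegative balance because the play
    passes all tests. *)
Lemma against_box sB l x q h v : is_strategy G s0 Box sB ->
  play x q l -> pi0 = h ++ moves x l -> det_play G s0 sD sB h -> is_run G s0 h ->
  last_state s0 h = (enc (locD x), v) -> shows x v q ->
  (forall c, tnth v c <= 1 + \sum_(y <- h) y.1) ->
  \sum_(y <- h) y.1 + \sum_(p <- l) p.1 <= Tm ->
  exists pi' x' b c v', drawing sB pi' x' b c v'.
Proof.
move=> hsB; elim: l x q h v => // -[d b] l IH x q h v /= [d0 xb hp hnx] epi hd hr hl hv hc.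
rewrite big_cons /= => hT.
have suml : 0 <= \sum_(p <- l) p.1.
  by case: (nx x b) hnx => [x'|->]; [exact: play_ge0|rewrite big_nil].
pose m1 : move := (d, edgeDB np x b);
  pose v1 := reset (delay v d) (resetting np [:: (wr x).*2.+1; z]).
have [dv1 z1] := post_write d hv; rewrite -/v1 in dv1 z1.
have c1 : can_take G (last_state s0 h) m1.
  by apply: legal_write hl hr hc _ => //; [exact: hv|lra].
pose h1 := rcons h m1.
have l1 : last_state s0 h1 = (enc (locB x b), v1) by rewrite last_state_rcons hl.
have r1 : is_run G s0 h1 by apply/is_run_rcons.
have sh : (size h < size pi0)%N by rewrite epi size_cat /= addnS ltnS leq_addr.
have d1 : det_play G s0 sD sB h1.
  apply/det_play_rcons; split=> //; rewrite /det_move hl /= encK; congr Some.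
  by rewrite /sD /follow sh {1}epi take_size_cat // eqxx /= epi nth_cat ltnn subnn.
have s1 := is_run_is_state hs0 r1; rewrite l1 in s1.
have c2 : can_take G (last_state s0 h1) (sB h1).
  by apply: hsB.1; split=> //=; rewrite l1 /= encK.
case em2 : (sB h1) c2 => [t e]; rewrite l1 => c2.
have t0 : t = 0 by exact: box_time c2 s1.
rewrite {}t0 in c2 em2.
pose h2 := rcons h1 ((0, e) : move).
have r2 : is_run G s0 h2 by apply/is_run_rcons; rewrite l1.
have d2 : det_play G s0 sD sB h2.
  by apply/det_play_rcons; split=> //; rewrite /det_move l1 /= encK em2.
have sum1 : \sum_(y <- h1) y.1 = \sum_(y <- h) y.1 + d by rewrite /h1 -cats1 big_cat big_seq1.
have sum2 : \sum_(y <- h2) y.1 = \sum_(y <- h) y.1 + d.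
  by rewrite /h2 -cats1 big_cat big_seq1 /= addr0 sum1.
have eh2 : h2 = h ++ [:: m1; (0, e)] by rewrite /h2 /h1 -!cats1 -catA.
have /can_takeP[[eo _ _] _] := c2; case: (outBP eo) => [[x' enx ee]|[c ee]].
  rewrite enx in hnx epi.
  apply: (IH x' (write q (wr x) d) h2 (reset (delay v1 0) (resetting np [:: (wr x').*2]))) =>
    //.
  - by rewrite epi eh2 -catA ee.
  - by rewrite last_state_rcons l1 /post ee.
  - exact: shows_next.
  - move=> i; rewrite sum2 !tnth_mktuple addr0.
    have S0 := run_ge0 hr.
    have := hc i; case: ifP => _; first lra.
    by case: ifP => _; lra.
  - rewrite sum2; lra.
exists h2, x, b, c, v1; split; first split=> //.
- by rewrite last_state_rcons l1 ee post_S.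
- exact: s1.
- by rewrite (@balance_ext _ (write q (wr x) d)).
- rewrite sum2; lra.
(* An early check differs from [pi0] in the target of its last label; at the end of the program
   [pi'] is as long as [pi0]. *)
- move=> [sz /(congr1 (fun y => nth point y (size h).+1))]; rewrite nth_take; last first.
    by rewrite eh2 size_cat /= addn2.
  rewrite eh2 epi !nth_cat ltnNge leqnSn /= subSn // subnn /= ee.
  case E : (nx x b) epi => [x'|] epi; last first.
    by move=> _; move: sz; rewrite eh2 epi !size_cat /= ltnn.
  by move=> /(congr1 (fun y : move => dec (tgt y.2))); rewrite /= !encK.
Qed.

Lemma diamond_wins_play : diamond_wins G mu s0 [set enc (locE true)]%SET D CGe 2^-1.
Proof.
have hpi0 : is_run G s0 pi0.
  have := @moves_legal l0 x0 q0 [::] v0 play0; rewrite big_nil add0r; apply => //.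
  by move=> c; rewrite addr0.
exists sD; first by apply: follow_strategy => //; exact: dflt_diamond_legal.
move=> sB hsB.
have [|||pi' [x [b [c [v [[hd hr hl] hB hbal hsum npre]]]]]] :=
    @against_box sB l0 x0 q0 [::] v0 hsB play0 erefl _ I erefl shows0.
- by [].
- by move=> i; rewrite big_nil addr0.
- by rewrite big_nil add0r.
have hs := is_run_is_state hs0 hr; rewrite hl in hs.
have z0 := is_state_clocks hB.
have hK i : cv v i <= K%:R.
  by case: hB => _ /=; rewrite encK /sat /= => /andP[_ /sat_all_clocks h]; exact: h.
pose s : state := (enc (locS x b c), v).
have os : owner G s.1 = Stochastic by rewrite /= encK.
have mV : measurable (delays G s) by rewrite draw_delays.
have muV : mu s (delays G s) = 1%E by exact: draw_mu1.
pose sink := [pred i : 'I_(nlocs P).+1 | if dec i is inr (inr _) then true else false].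
have selsink t : sink (tgt (sel K x b c v t)).
  have [j [be ->]] : exists j be, sel K x b c v t = win_edge np K x b c j be by exact: sel_out.
  by rewrite /= encK.
have sinkE i : sink i -> exists w, i = enc (locE w).
  by rewrite -[i]decK /= encK; case: (dec i) => [[?|[? ?]]|[[[? ?] ?]|w]] // _; exists w.
have loopl i : sink i -> tgt (dfl i).2 = i by move=> /sinkE[w ->]; rewrite /dfl encK.
have sinkD i : sink i -> owner G i = Diamond by move=> /sinkE[w ->]; rewrite /= encK.
have uG : uniq (edges G) by exact: undup_uniq.
have wG e : e \in edges G -> src e = s.1 -> (0 < weight G e)%N by [].
have msel S : measurable [set t | S (sel K x b c v t)] by exact: measurable_sel.
have selE t : delays G s t -> forall e, can_take G s (t, e) <-> e = sel K x b c v t by exact: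
  selP.
have sDloop y j : sink (tgt y.2) ->
    sD (rcons pi' y ++ nseq j (dfl (tgt y.2))) = dfl (tgt y.2).
  move=> sy; rewrite /sD /follow ifF.
    congr dfl; rewrite /last_state foldl_cat foldl_rcons. apply: (last_state_loops loopl) => //.
  apply/negP => /andP[sz /eqP e]; apply: npre; split.
    by apply: leq_ltn_trans sz; rewrite size_cat size_rcons; lia.
  have := congr1 (take (size pi')) e; rewrite take_takel; last first.
    by rewrite size_cat size_rcons; lia.
  by move=> <-; rewrite -cats1 -catA take_size_cat.
have [Pr hPr PrE] := draw_law uG wG os mV muV msel selE hd hl selsink sinkD loopl sDloop.
have mwin : measurable [set t | tgt (sel K x b c v t) = enc (locE true)].
  exact: (msel [set e | tgt e = enc (locE true)]).
exists Pr => //=; rewrite PrE.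
apply: (@le_trans _ _ (mu s ([set t | tgt (sel K x b c v t) = enc (locE true)] `&` delays G
  s))).
  rewrite probability_setI_full // draw_win //.
  rewrite lee_fin lerDl; apply: divr_ge0; last exact: mulr_ge0.
  exact: hbal.
apply: le_measure; rewrite ?inE.
- exact: measurableI mwin mV.
- rewrite -[X in measurable X]setTI.
  exact: (measurable_draw_path msel _ _ measurableT (measurable_reach G s0 _ D)).
- move=> t [/= tw tV]; rewrite /mkset; apply: (draw_path_reach selE hl selsink loopl hr) => //.
  + move=> [i v'] /sinkE[w /= ->]; rewrite /dflt encK; apply/can_takeP.
    by split; split; rewrite ?mem_head ?encK.
  + by rewrite tw inE.
  (* A test has at most three terms, hence six windows. *)
  have : t < 6 * K%:R; last by move: hsum TmD; lra.
  move: tV; rewrite draw_delays //= in_itv /= z0 subr0 => /andP[_ tW].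
  apply: lt_le_trans tW _; rewrite ler_wpM2r // ler_nat size_wins.
  by have /andP[_ h] := @ts0 x b c; rewrite -[6%N]/(3.*2)%N leq_double.
Qed.

End DiamondWins.
End Winning.

(** * Codes *)

Lemma pickle_pair (T1 T2 : countType) (a : T1) (b : T2) :
  pickle (a, b) = (2 ^ pickle a * (2 ^ pickle b).*2.+1)%N.
Proof. by rewrite -[pickle _]/(CodeSeq.code [:: pickle a; pickle b]) /= muln1. Qed.

(** A natural number inside [int] is encoded as the pair of lists [[:: m]] and [[::]]; the empty one
    accounts for the factor 3. *)
Lemma pickle_Posz (m : nat) : pickle (Posz m) = (2 ^ 2 ^ m * 3)%N.
Proof.
rewrite -[pickle _]/(CodeSeq.code [:: CodeSeq.code [:: m]; CodeSeq.code [::]]).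
by rewrite /= !muln1.
Qed.

Lemma pickle_pow2V (c : nat) : pickle ((2 ^ c)%N%:R^-1 : rat) =
  (2 ^ pickle (1 : int) * (2 ^ (2 ^ 2 ^ 2 ^ c * 3)).*2.+1)%N.
Proof.
have e : ((2 ^ c)%N%:R^-1 : rat) = (1 : int)%:~R / (Posz (2 ^ c))%:~R by rewrite div1r.
have p0 : (Posz (2 ^ c) == 0) = false by apply/negbTE; rewrite eqz_nat -lt0n expn_gt0.
rewrite -[pickle (_ : rat)]/(CodeSeq.code [:: pickle (numq _); pickle (denq _)]).
rewrite e coprimeq_num ?coprimeq_den ?coprime1n // p0 ger0_norm // pickle_Posz.
rewrite (_ : sgz _ * 1 = 1) /= ?muln1 // mulr1 gtr0_sgz // ltz_nat expn_gt0 //.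
Qed.

Section Instance.
Variables (u nr : nat) (Q : seq instr).

Definition pair_count := nr.*2.+1.
Definition clock_bound := (4 * nr).+1.
Definition game_of := arena_of (qprog_of nr Q) pair_count clock_bound.
Definition start : node (qprog_of nr Q) := (ord0, false).

(** Only clock 0 depends on [c]: register 0 starts at [c], since its first quantity is [2^-c]. All
    other register quantities are 1, which stands for empty registers, and the temporary one is
    0. *)
Definition clock_value (c j : nat) : rat :=
  if j == 0%N then (2 ^ c)%N%:R^-1 else if ~~ odd j && (j < nr.*2.*2)%N then 1 else 0.

Definition clock_values (c : nat) : (nclk pair_count).+1.-tuple rat :=
  [tuple clock_value c i | i < (nclk pair_count).+1].

(** Enough for a correct play of length [4 * nr] and a draw of length at most [6 * clock_bound]. *)
Definition duration : rat := (10 * clock_bound)%N%:R.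

Definition instance_of (c : nat) : instance :=
  @Instance _ _ game_of u [set enc (locE _ true)]%SET (enc (locD start)) (clock_values c)
    duration CGe 2^-1.

(** The input 0 is immaterial: none of these components involves the clock values. Hence the game
    code can itself serve as the input without circularity. *)
Definition game_code : nat :=
  let x := instance_of 0 in
  pickle (nloc x, nclock x, pickle (edges (game x)),
    pickle [seq weight (game x) e | e <- edges (game x)],
    pickle [seq pickle (Defs.invariant (game x) l) | l <- enum 'I_(nloc x).+1],
    pickle [seq owner (game x) l | l <- enum 'I_(nloc x).+1],
    delay_name x, pickle (enum (target x)), pickle (init_loc x)).
End Instance.

Definition other_clocks_code (nr : nat) : nat :=
  CodeSeq.code [seq pickle (clock_value nr 0 i) | i <- iota 1 (nclk (pair_count nr))].

Lemma clock_codes nr c N : [seq pickle (clock_value nr c i) | i <- iota 0 N.+1] =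
  pickle ((2 ^ c)%N%:R^-1 : rat) :: [seq pickle (clock_value nr 0 i) | i <- iota 1 N].
Proof.
rewrite /=; congr (_ :: _); apply/eq_in_map => i; rewrite mem_iota => /andP[i0 _].
by rewrite /clock_value gtn_eqF.
Qed.

Lemma pickle_clock_values nr c : pickle (clock_values nr c) =
  (2 ^ pickle ((2 ^ c)%N%:R^-1 : rat) * (other_clocks_code nr).*2.+1)%N.
Proof.
rewrite -[pickle _]/(CodeSeq.code (map pickle (clock_values nr c))).
rewrite -[map pickle (clock_values nr c)]/(map pickle
  (map (fun i : 'I_(nclk (pair_count nr)).+1 => clock_value nr c i) (enum 'I_(nclk (pair_count
    nr)).+1))).
rewrite -map_comp (map_comp (pickle \o clock_value nr c) val) val_enum_ord.
by rewrite (clock_codes nr c (nclk (pair_count nr))).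
Qed.

Definition const_code (T : countType) (a : T) : nat := (2 ^ pickle a).*2.+1.

Lemma code_instance u nr Q : let c := game_code u nr Q in
  Defs.code (instance_of u nr Q c) =
  diag_code (pickle (1 : int)) (other_clocks_code nr).*2.+1 (const_code (duration nr))
    (const_code CGe) (const_code (2^-1 : rat)) c.
Proof.
move=> c; rewrite /Defs.code /diag_code.
rewrite 4!pickle_pair.
rewrite -[init_val _]/(clock_values nr c).
rewrite -pickle_pow2V -pickle_clock_values.
by [].
Qed.

(** * Conclusion *)

Section Correct.
Variables (R : realType) (nr : nat) (Q : seq instr).
Hypotheses (Qnr : instrs_below nr Q) (Q0 : (0 < size Q)%N).
Local Notation P := (qprog_of nr Q).
Local Notation np := (pair_count nr).

Lemma nth_test_ind (H : test -> Prop) (x : node P) b c : H trivial_test ->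
  (forall t, t \in mts nr x b -> H t) -> H (nth_test x b c).
Proof.
move=> h0 h; rewrite /nth_test; case: (ltnP c (size (mts nr x b))) => cs;
  last by rewrite nth_default.
by apply: h; apply: mem_nth.
Qed.

Lemma mts_cases (x : node P) b t : t \in mts nr x b ->
  (0 < size t <= 3)%N /\ forall p, p \in t -> (p.1 < np)%N.
Proof.
have clt := changed_lt Qnr Q0 x.
have cltnp : (changed (instr_at x) < np)%N by rewrite /pair_count; lia.
have tlt : (nr.*2 < np)%N by rewrite /pair_count; lia.
have h i j : (i < np)%N -> (j < np)%N ->
    forall s, s \in eq_tests i j ++ half_tests i j ++ [:: [:: (i, true); (j, false)]] ->
    (0 < size s <= 3)%N /\ forall p, p \in s -> (p.1 < np)%N.
  move=> inp jnp s; rewrite !inE => /or4P[|||/orP[]] /eqP -> //=; split=> // p; rewrite !inE.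
  - by case/orP => /eqP ->.
  - by case/orP => /eqP ->.
  - by case/or3P => /eqP ->.
  - by case/or3P => /eqP ->.
  - by case/orP => /eqP ->.
rewrite /mts; case: ifP => _.
  by move=> ht; apply: (h _ _ cltnp tlt); rewrite mem_cat ht.
move: clt; case: (instr_at x) => [r|r q] /= clt.
  by move=> ht; apply: (h nr.*2 r.*2) => //; [rewrite /pair_count; lia|rewrite !mem_cat ht
    orbT].
case: b.
  by move=> ht; apply: (h r.*2 r.*2.+1); rewrite ?mem_cat ?ht // /pair_count; lia.
rewrite inE => /predU1P[->|]; last rewrite inE => /predU1P[->|]; last rewrite inE => /eqP ->.
- by apply: (h nr.*2 r.*2.+1); rewrite ?inE ?eqxx ?orbT // /pair_count; lia.
- by apply: (h nr.*2 r.*2.+1); rewrite ?inE ?eqxx ?orbT // /pair_count; lia.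
- by apply: (h nr.*2 r.*2); rewrite ?inE ?eqxx ?orbT // /pair_count; lia.
Qed.

Lemma nth_test_size (x : node P) b c : (0 < size (nth_test x b c) <= 3)%N.
Proof. by apply: (nth_test_ind (H := fun t => (0 < size t <= 3)%N)) => // t /mts_cases[]. Qed.

Lemma nth_test_pairs (x : node P) b c p : p \in nth_test x b c -> (p.1 < np)%N.
Proof.
apply: (nth_test_ind (H := fun t => p \in t -> (p.1 < np)%N)); last by move=> t /mts_cases[_];
  exact.
by rewrite !inE => /orP[] /eqP ->.
Qed.

Lemma ts_size (x : node P) b : (size (ts x b) <= 3)%N.
Proof. by rewrite /= /mts; case: ifP => // _; case: (instr_at x) => [r|r q] //; case: b. Qed.

Lemma wr_lt (x : node P) : (wr x < np)%N.
Proof.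
rewrite /= /mwr /pair_count; case: ifP => _ //.
by have := changed_lt Qnr Q0 x; lia.
Qed.

Variables (u c : nat).
Let x := instance_of u nr Q c.
Let v0 : valuation R (nclk np).+1 := (init_state R x).2.

Lemma tnth_v0 i : tnth v0 i = ratr (clock_value nr c i).
Proof. by rewrite /v0 /init_state /= !tnth_mktuple. Qed.

Lemma cv_v0 j : (j <= nclk np)%N -> cv v0 j = ratr (clock_value nr c j).
Proof. by move=> jn; rewrite /cv tnth_v0 inordK. Qed.

Lemma clock_value_ge0_le1 j : 0 <= clock_value nr c j <= 1.
Proof.
rewrite /clock_value; case: ifP => _; last by case: ifP.
by rewrite invr_ge0 ler0n invf_le1 ?ltr0n ?ler1n ?expn_gt0.
Qed.
Let f0 := set_reg (fun=> 0%N) 0 c.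

Lemma diffs_v0 r : (r < nr)%N ->
  diffs v0 r.*2 = 2^-1 ^+ (f0 r) /\ diffs v0 r.*2.+1 = 1.
Proof.
move=> rnr; rewrite /diffs !cv_v0 /nclk /pair_count; try lia.
have h1 : clock_value nr c r.*2.*2.+1 = 0.
  by rewrite /clock_value /= !odd_double.
have h2 : clock_value nr c r.*2.+1.*2 = 1.
  by rewrite /clock_value /= odd_double ifT //=; lia.
have h3 : clock_value nr c r.*2.+1.*2.+1 = 0.
  by rewrite /clock_value /= !odd_double.
rewrite h1 h2 h3 !rmorph0 !subr0 rmorph1; split=> //.
rewrite /clock_value /f0 /set_reg !double_eq0; case: eqP => [_|r0].
  by rewrite fmorphV rmorph_nat natrX exprVn.
by rewrite !odd_double /= ifT ?rmorph1 //; lia.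
Qed.

Lemma diffs_v0_le1 i : (i < nr.*2)%N -> diffs v0 i <= 1.
Proof.
move=> inr; have [|h1 h2] := @diffs_v0 i./2; first lia.
rewrite -(odd_double_half i); case: odd; rewrite ?add1n ?add0n ?h1 ?h2 //.
by apply: exprn_ile1; lra.
Qed.

Lemma represents_v0 : represents nr (diffs v0) f0.
Proof.
by exists (fun=> 0%N) => r rnr; rewrite addn0; exact: diffs_v0.
Qed.

Lemma is_state_v0 : is_state (game_of nr Q) (init_state R x).
Proof.
split=> [i|]; first by rewrite tnth_v0 ler0q; case/andP: (clock_value_ge0_le1 i).
rewrite /= encK; apply/sat_all_clocks => i; rewrite -/v0 tnth_v0.
have /andP[_ h] := clock_value_ge0_le1 i; apply: (@le_trans _ _ 1).
  by rewrite -(rmorph1 (@ratr R)) ler_rat.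
by rewrite ler1n.
Qed.

(** The first node writes the temporary quantity, whose clocks start at 0. Its first clock differs
    from clock 0 because [nr] is positive, the program having an instruction. *)
Lemma shows_v0 : shows (start nr Q) v0 (diffs v0).
Proof.
split=> //; rewrite /= /mwr /= cv_v0 /nclk /pair_count; last lia.
rewrite /clock_value ltnn andbF double_eq0 double_eq0 ifF ?rmorph0 //.
apply/negbTE; rewrite -lt0n; move/(all_nthP (Inc 0)): Qnr => /(_ 0%N Q0); lia.
Qed.

Variable (N : delay_naming R).
Hypothesis hu : forall n k (A : timed_automaton n k) (s : state R n k), is_state A s ->
  (0 < lebesgue_measure (delays A s) < +oo)%E -> forall B : set R, measurable B ->
  N u A s B = (fine (lebesgue_measure (B `&` delays A s)) /
               fine (lebesgue_measure (delays A s)))%:E.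

Lemma valid_instance : valid N x.
Proof.
split.
- apply: arena_is_stg => //; last by move=> s; exact: hu.
- exact: is_state_v0.
- by rewrite /= /duration ler0n.
- by [].
Qed.

Lemma tracks_v0 : tracks nr f0 (start nr Q) (diffs v0).
Proof. by exists 0%N, f0; split=> //; exact: represents_v0. Qed.

Lemma yes_instanceE : yes_instance N x = diamond_wins (game_of nr Q) (@instance_measures R N x)
  (init_state R x) [set enc (locE _ true)]%SET (ratr (duration nr)) CGe 2^-1.
Proof. by rewrite /yes_instance /= fmorphV !rmorph_nat. Qed.

Lemma halts_yes : halts Q f0 -> yes_instance N x.
Proof.
move=> [j hj]; rewrite yes_instanceE.
have [l [hl suml]] := play_exists Qnr Q0 represents_v0 hj.
have e0 : at_pc Q 0 = Some (start nr Q).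
  by rewrite /at_pc Q0; congr (Some (_, _)); apply: val_inj; rewrite /= inordK.
rewrite e0 in hl.
have sum1 : \sum_(i < nr.*2) diffs v0 i <= (nr.*2)%:R.
  rewrite -[X in _ <= X%:R]card_ord -sum1_card natr_sum; apply: ler_sum => i _.
  exact: diffs_v0_le1.
apply: (@diamond_wins_play R P np (clock_bound nr) (@instance_measures R N x) _ _ _ _ _
  (start nr Q) (diffs v0) l v0 _ (4 * nr)%:R) => //.
- exact: nth_test_size.
- exact: nth_test_pairs.
- exact: wr_lt.
- by move=> s; exact: hu.
- exact: is_state_v0.
- exact: shows_v0.
- move=> i; rewrite tnth_v0 -(rmorph1 (@ratr R)) ler_rat.
  by case/andP: (clock_value_ge0_le1 i).
- apply: le_trans suml _; apply: (le_trans (ler_wpM2l _ sum1)) => //.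
  by rewrite -natrM ler_nat; lia.
- by rewrite /clock_bound -natr1 addrC.
- rewrite /duration rmorph_nat -natrM -natrD ler_nat /clock_bound; lia.
Qed.

Lemma loops_no : ~ halts Q f0 -> ~ yes_instance N x.
Proof.
move=> nh; rewrite yes_instanceE.
apply: (@diamond_loses R P np (clock_bound nr) (@instance_measures R N x) _ _ _ _ _ _
  (fun y q => tracks nr f0 y q) (start nr Q) (diffs v0) v0) => //.
- exact: nth_test_size.
- exact: ts_size.
- exact: nth_test_pairs.
- exact: wr_lt.
- by move=> s; exact: hu.
- exact: tracks_v0.
(* Non-termination excludes the case of [tracks_step] without a next node. *)
- move=> y q d b hy d0 yb hp; have := tracks_step Qnr Q0 hy yb hp.
  by rewrite /=; case: (mnx y b) => // y' hy'; exists y'.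
- exact: is_state_v0.
- exact: shows_v0.
Qed.

End Correct.

Lemma exists_fresh_register (M : seq instr) : exists z, (3 < z)%N /\ instrs_below z M.
Proof.
elim: M => [|i M [z [z3 hz]]]; first by exists 4%N.
exists (maxn z (instr_reg i).+1); split; first by rewrite leq_max z3.
rewrite /instrs_below /= leq_max ltnSn orbT /=.
by move: hz; rewrite /instrs_below; apply: sub_all => j jz; rewrite leq_max jz.
Qed.

Theorem theorem3 (R : realType) (N : delay_naming R) (hN : names_uniform N) :
  ~ (exists M : seq instr, decides_from N 5 M).
Proof.
move=> [M hM]; have [u hu] := hN; have [z [z3 hz]] := exists_fresh_register M.
(* Register [z] is used by the diagonal machine too and must be simulated. *)
pose nr := z.+1.
pose Q := diag_machine z M (pickle (1%Z)) (other_clocks_code nr).*2.+1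
  (const_code (duration nr)) (const_code CGe) (const_code (2^-1 : rat))%R.
have Qnr : instrs_below nr Q by exact: diag_machine_below.
have Q0 : (0 < size Q)%N by rewrite /Q size_diag_machine.
pose c := game_code u nr Q.
have hu' n k (A : timed_automaton n k) (s : state R n k) (hs : is_state A s) := (hu n k A s
  hs).1.
have hv : valid N (instance_of u nr Q c) by exact: valid_instance.
(* The game has [4 * nr + 3] clocks with [nr = z.+1], so the lower bound 5 holds by computation. *)
have [hyes hno] := hM _ hv isT.
rewrite code_instance in hyes hno.
have yes_loops : yes_instance N (instance_of u nr Q c) -> ~ halts Q (set_reg (fun=> 0%N) 0%N c).
  by move=> /hyes; exact: diag_machine_loops.
(* A positive answer makes [Q] loop on [c], so that Diamond loses; a negative one makes it halt, so
   that Diamond wins. *)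
have [y|n] := pselect (yes_instance N (instance_of u nr Q c)).
  by apply: (loops_no Qnr Q0 hu' (yes_loops y)).
have hQ := diag_machine_halts z3 hz (hno n).
by apply: n; apply: halts_yes.
Qed.
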